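(* Let $n\ge 1$ and let $T$ be a noncrossing tree in the based regular $(n+1)$-gon. Write its image in the dendriform operad as $\Theta(T)=\sum_{t\in I}t$, where $I$ is a set of planar binary trees with $n$ vertices. Then $I$ is the interval of the Tamari lattice $\mathrm{Tam}_n$ that corresponds to the exceptional interval-poset $P_T=(\{1,\dots,n\},\lhd_T)$.
   Context: **Binary trees and the Tamari lattice.** A (planar) binary tree of size $n$ is a rooted planar tree with $n$ inner vertices, each having a left child and a right child (each child is an inner vertex or a leaf); it has $n+1$ leaves. ''Vertex'' means inner vertex. Write $X\wedge Z$ for the tree whose root has left subtree $X$ and right subtree $Z$. $\mathrm{Tam}_n$ is the set of binary trees of size $n$, ordered by the reflexive transitive closure of the covering relation in which a tree is covered by any tree obtained from it by replacing one subtree of the form $(A\wedge B)\wedge C$ by $A\wedge(B\wedge C)$. The vertices of a tree $S$ of size $n$ are labelled $1,\dots,n$ in in-order (recursively: left subtree, root, right subtree), and $i\lhd_S j$ means that vertex $i$ lies in the subtree rooted at vertex $j$ (including $i=j$). **Interval-posets.** An interval-poset of size $n$ is a (reflexive) partial order $\lhd$ on $\{1,\dots,n\}$ such that for all $a<b<c$: $a\lhd c$ implies $b\lhd c$, and $c\lhd a$ implies $b\lhd a$. For $a<b$, a relation $a\lhd b$ is called increasing and a relation $b\lhd a$ decreasing. The interval-poset corresponding to an interval $[S,T']$ of $\mathrm{Tam}_n$ is the reflexive relation whose decreasing relations are those of $\lhd_S$ and whose increasing relations are those of $\lhd_{T'}$; this is a (known) bijection between intervals of $\mathrm{Tam}_n$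 and interval-posets of size $n$. An interval-poset is exceptional if its Hasse diagram contains no $x<y<z$ such that both $y\lhd x$ and $y\lhd z$ are cover relations. **Noncrossing trees.** Label the vertices of the regular $(n+1)$-gon $0,1,\dots,n$ clockwise, so that side $i$ ($1\le i\le n$) joins $i-1$ and $i$, and the base (side $0$) joins $n$ and $0$. A noncrossing tree is a set of pairwise noncrossing edges (sides or diagonals) forming a tree on all the vertices $0,\dots,n$; it has $n$ edges. For $1\le a\le b\le n$ let $[a,b]$ denote the edge joining the vertices $a-1$ and $b$ (so side $i$ is $[i,i]$, and the base is $[1,n]$). The label of an edge $e=[a,b]$ of $T$ is the unique $i\in\{a,\dots,b\}$ that belongs to no $\{a',\dots,b'\}$ with $[a',b']$ an edge of $T$ different from $e$ and $a\le a'\le b'\le b$; this labels the edges of $T$ bijectively by $1,\dots,n$. Set $i\lhd_T j$ if the edge labelled $i$ is separated from the base by the edge labelled $j$ (or $i=j$), i.e. if the edges $[i_1,i_2]$, $[j_1,j_2]$ labelled $i$, $j$ satisfy $j_1\le i_1\le i_2\le j_2$. **The dendriform operad.** $\mathbf{Dend}$ is the nonsymmetric operad generated by two binary operations $\prec,\succ$ with relations $(x\prec y)\prec z=x\prec(y\prec z+y\succ z)$, $(x\succ y)\prec z=x\succ(y\prec z)$, $(x\prec y+x\succ y)\succ z=x\succ(y\succ z)$. $\mathbf{Dend}(n)$ has as basis the planar binary trees with $n$ vertices: the one-vertex tree is the operadic unit, and the tree with left subtree $l$, root labelled $k$ and right subtree $r$ is the operation $(l(x_1,\dots,x_{k-1})\succ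 x_k)\prec r(x_{k+1},\dots,x_n)$ (omitting $l\,\succ$ or $\prec r$ when the corresponding subtree is a leaf). **Composition of noncrossing trees and the map $\Theta$.** For noncrossing trees $f,g$ in based polygons, $f\circ_i g$ is obtained by glueing the base of the polygon of $g$ on the side $i$ of the polygon of $f$ and taking the union of the two trees, except that along the glueing diagonal: if the diagonal is present in both $f$ and $g$ it is kept; if it is present in exactly one of them, it is removed. In these cases $f\circ_i g$ is a noncrossing tree. (If it is in neither, the composite in the larger operad $\mathbf{NCP}$ of noncrossing plants is not a noncrossing tree.) On noncrossing trees, the injective operad morphism $\Theta:\mathbf{NCP}\to\mathbf{Dend}$ is the unique family of maps such that: the unique noncrossing tree for $n=1$ (the operadic unit) goes to the unit; in the triangle, with sides $0$ (base), $1$, $2$, one has $\Theta(\{0,1\})=x_1\succ x_2$, $\Theta(\{0,2\})=x_1\prec x_2$, $\Theta(\{1,2\})=x_1\prec x_2+x_1\succ x_2$; and $\Theta(f\circ_i g)=\Theta(f)\circ_i\Theta(g)$ whenever the glueing diagonal is in at least one of $f,g$. It is known that $\Theta(T)$ is, for every noncrossing tree $T$, a sum $\sum_{t\in I}t$ of distinct binary trees. *)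

(* Defs.v *)
From HB Require Import structures.
From Stdlib Require Export Relation_Operators.
From mathcomp Require Export all_boot all_order all_algebra.
From mathcomp.finmap Require Export finmap.
From mathcomp.multinomials Require Export monalg.

Set Implicit Arguments.
Unset Strict Implicit.
Unset Printing Implicit Defensive.

Import GRing.Theory.

(** * Binary trees and the Tamari order *)

Inductive btree : Type := BLeaf | BNode of btree & btree.

Fixpoint btree_encode (t : btree) : GenTree.tree unit :=
  match t with
  | BLeaf => GenTree.Leaf tt
  | BNode l r => GenTree.Node 0 [:: btree_encode l; btree_encode r]
  end.

Fixpoint btree_decode (t : GenTree.tree unit) : option btree :=
  match t with
  | GenTree.Leaf _ => Some BLeaf
  | GenTree.Node _ [:: l; r] =>
      if btree_decode l is Some l' then
        if btree_decode r is Some r' then Some (BNode l' r') else None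
      else None
  | _ => None
  end.

Lemma btree_encodeK : pcancel btree_encode btree_decode.
Proof. by elim=> //= l -> r ->. Qed.

HB.instance Definition _ := Countable.copy btree (pcan_type btree_encodeK).

(* Number of inner vertices. *)
Fixpoint bsize (t : btree) : nat :=
  if t is BNode l r then (bsize l + bsize r).+1 else 0.

Inductive tam_cover : btree -> btree -> Prop :=
| TamRot a b c :
    tam_cover (BNode (BNode a b) c) (BNode a (BNode b c))
| TamLeft l l' r : tam_cover l l' -> tam_cover (BNode l r) (BNode l' r)
| TamRight l r r' : tam_cover r r' -> tam_cover (BNode l r) (BNode l r').

Definition tam_le : btree -> btree -> Prop := clos_refl_trans btree tam_cover.

(* [tree_lhd t i j]: in the in-order labelling of [t] by 1, ..., bsize t, the
   vertex [i] lies in the subtree rooted at the vertex [j].  The vertices of the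
   right subtree are the ones labelled after the root, whence the shift. *)
Fixpoint tree_lhd (t : btree) (i j : nat) : bool :=
  if t is BNode l r then
    let k := (bsize l).+1 in
    if j == k then (0 < i <= bsize t)%N
    else if (j < k)%N then tree_lhd l i j
    else (k < i)%N && tree_lhd r (i - k) (j - k)
  else false.

(** * Interval-posets *)

(* A relation on {1, ..., n} is given as a relation on [nat] which relates only
   elements of {1, ..., n}. *)
Record interval_poset (n : nat) (P : nat -> nat -> Prop) : Prop := {
  ip_dom : forall i j, P i j -> (0 < i <= n)%N /\ (0 < j <= n)%N;
  ip_refl : forall i, (0 < i <= n)%N -> P i i;
  ip_anti : forall i j, P i j -> P j i -> i = j;
  ip_trans : forall i j k, P i j -> P j k -> P i k;
  ip_incr : forall a b c, (a < b < c)%N -> P a c -> P b c;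
  ip_decr : forall a b c, (a < b < c)%N -> P c a -> P b a
}.

Definition cover_rel (P : nat -> nat -> Prop) (x y : nat) : Prop :=
  [/\ P x y, x <> y & forall z, P x z -> P z y -> z = x \/ z = y].

Definition exceptional (P : nat -> nat -> Prop) : Prop :=
  ~ exists x y z, [/\ (x < y < z)%N, cover_rel P y x & cover_rel P y z].

(* The interval-poset of the interval [S, S'] of the Tamari lattice of size n. *)
Definition interval_lhd (n : nat) (S S' : btree) (i j : nat) : Prop :=
  [\/ i = j /\ (0 < i <= n)%N,
      (j < i)%N /\ tree_lhd S i j
    | (i < j)%N /\ tree_lhd S' i j].

(** * Noncrossing trees *)

(* An edge of the polygon with vertices 0, ..., n is a pair (p, q), p < q; it is
   the edge written [p+1, q] in terms of the sides it separates from the base.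
   Side i is (i-1, i) and the base is (0, n); for n = 1 they are the same edge
   of a digon. *)
Definition edge : Type := (nat * nat)%type.

Definition adj (n : nat) (E : {fset edge}) : rel 'I_n.+1 :=
  fun x y => ((val x, val y) \in E) || ((val y, val x) \in E).

Record noncrossing_tree (n : nat) (E : {fset edge}) : Prop := {
  nct_edge : forall e, e \in E -> (e.1 < e.2 <= n)%N;
  nct_noncrossing : forall e f, e \in E -> f \in E ->
    ~ [/\ (e.1 < f.1)%N, (f.1 < e.2)%N & (e.2 < f.2)%N];
  nct_connected : forall x y : 'I_n.+1, connect (adj E) x y;
  nct_acyclic : forall c : seq 'I_n.+1,
    cycle (adj E) c -> uniq c -> (size c <= 2)%N
}.

Record nctree (n : nat) : Type := NCTree {
  edges :> {fset edge};
  edgesP : noncrossing_tree n edges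
}.

Definition edge_label (E : {fset edge}) (e : edge) (i : nat) : Prop :=
  (e.1 < i <= e.2)%N /\
  forall f, f \in E -> f <> e -> (e.1 <= f.1)%N -> (f.2 <= e.2)%N ->
    ~ (f.1 < i <= f.2)%N.

Definition nct_lhd (E : {fset edge}) (i j : nat) : Prop :=
  exists e f : edge,
    [/\ e \in E, f \in E, edge_label E e i, edge_label E f j &
        (f.1 <= e.1)%N /\ (e.2 <= f.2)%N].

(* Gluing the base of the polygon of [g], which has k sides besides its base, on
   the side i of the polygon of [f]; the gluing diagonal becomes (i-1, i-1+k). *)
Definition nc_glue (f : {fset edge}) (i k : nat) (g : {fset edge}) :
    {fset edge} :=
  let sh v := if (v < i)%N then v else (v + k).-1 in
  let u := ([fset (sh e.1, sh e.2) | e in f] `|`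
            [fset (e.1 + i.-1, e.2 + i.-1)%N | e in g])%fset in
  if ((i.-1, i) \in f) && ((0, k) \in g) then u
  else (u `\ (i.-1, i.-1 + k)%N)%fset.

(** * The dendriform operad, by generators and relations *)

(* Monomials of the free nonsymmetric operad on two binary operations; the
   inputs are the occurrences of [DVar], numbered from left to right. *)
Inductive dterm : Type :=
| DVar
| DPrec of dterm & dterm
| DSucc of dterm & dterm.

Fixpoint dterm_encode (t : dterm) : GenTree.tree unit :=
  match t with
  | DVar => GenTree.Leaf tt
  | DPrec l r => GenTree.Node 0 [:: dterm_encode l; dterm_encode r]
  | DSucc l r => GenTree.Node 1 [:: dterm_encode l; dterm_encode r]
  end.

Fixpoint dterm_decode (t : GenTree.tree unit) : option dterm :=
  match t with
  | GenTree.Leaf _ => Some DVar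
  | GenTree.Node k [:: l; r] =>
      if dterm_decode l is Some l' then
        if dterm_decode r is Some r' then
          Some (if k is 0 then DPrec l' r' else DSucc l' r')
        else None
      else None
  | _ => None
  end.

Lemma dterm_encodeK : pcancel dterm_encode dterm_decode.
Proof. by elim=> //= l -> r ->. Qed.

HB.instance Definition _ := Countable.copy dterm (pcan_type dterm_encodeK).

Fixpoint arity (t : dterm) : nat :=
  match t with
  | DVar => 1
  | DPrec l r | DSucc l r => arity l + arity r
  end.

(* Substitution of [s] for the i-th input of [t], 1 <= i <= arity t. *)
Fixpoint dsubst (t : dterm) (i : nat) (s : dterm) : dterm :=
  match t with
  | DVar => s
  | DPrec l r => if (i <= arity l)%N then DPrec (dsubst l i s) r
                 else DPrec l (dsubst r (i - arity l) s)
  | DSucc l r => if (i <= arity l)%N then DSucc (dsubst l i s) r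
                 else DSucc l (dsubst r (i - arity l) s)
  end.

Section Dend.

Variable K : comNzRingType.

Local Open Scope ring_scope.

(* The component of arity n of the free operad over K consists of the elements
   [f : {malg K[dterm]}] such that [of_arity n f]. *)
Definition of_arity (n : nat) (f : {malg K[dterm]}) : Prop :=
  forall t, t \in msupp f -> arity t = n.

Definition dcomp (f : {malg K[dterm]}) (i : nat) (g : {malg K[dterm]}) :
    {malg K[dterm]} :=
  \sum_(t <- msupp f) \sum_(s <- msupp g) << f@_t * g@_s *g dsubst t i s >>.

Local Notation x := DVar.

(* The component of arity n of the operadic ideal generated by the dendriform
   relations. *)
Inductive dend_ideal : nat -> {malg K[dterm]} -> Prop :=
| DendRel1 : dend_ideal 3
    (<< DPrec (DPrec x x) x >>
     - (<< DPrec x (DPrec x x) >> + << DPrec x (DSucc x x) >>))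
| DendRel2 : dend_ideal 3
    (<< DPrec (DSucc x x) x >> - << DSucc x (DPrec x x) >>)
| DendRel3 : dend_ideal 3
    (<< DSucc (DPrec x x) x >> + << DSucc (DSucc x x) x >>
     - << DSucc x (DSucc x x) >>)
| DendZero n : dend_ideal n 0
| DendAdd n f g : dend_ideal n f -> dend_ideal n g -> dend_ideal n (f + g)
| DendScale n (c : K) f : dend_ideal n f -> dend_ideal n (c *: f)
| DendCompL m n i f g : (0 < i <= m)%N ->
    dend_ideal m f -> of_arity n g -> dend_ideal (m + n).-1 (dcomp f i g)
| DendCompR m n i f g : (0 < i <= m)%N ->
    of_arity m f -> dend_ideal n g -> dend_ideal (m + n).-1 (dcomp f i g).

(* Equality in Dend(n). *)
Definition dend_eq (n : nat) (f g : {malg K[dterm]}) : Prop :=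
  dend_ideal n (f - g).

End Dend.

(* The operation (l > x_k) < r attached to a binary tree with at least one
   vertex; the value on [BLeaf] is irrelevant. *)
Fixpoint dend_of_tree (t : btree) : dterm :=
  match t with
  | BLeaf => DVar
  | BNode l r =>
      let u := if l is BLeaf then DVar else DSucc (dend_of_tree l) DVar in
      if r is BLeaf then u else DPrec u (dend_of_tree r)
  end.

(* [f] is, in Dend(n), the sum of the distinct binary trees of size n in [I]. *)
Definition is_tree_sum (K : comNzRingType) (n : nat) (f : {malg K[dterm]})
    (I : {fset btree}) : Prop :=
  (forall t, t \in I -> bsize t = n) /\
  dend_eq n f (\sum_(t <- I) << dend_of_tree t >>)%R.

(** * The morphism Theta on noncrossing trees *)

(* The conditions characterizing Theta; [Theta T] is a representative of an
   element of Dend(n) when T is a noncrossing tree with n edges.  In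
   [theta_comp], the tree [h] is the composite of [f] and [g] at [i]. *)
Record is_Theta (K : comNzRingType)
    (Theta : forall n, nctree n -> {malg K[dterm]}) : Prop := {
  theta_arity : forall n (T : nctree n), (0 < n)%N -> of_arity n (Theta n T);
  theta_unit : forall T : nctree 1, dend_eq 1 (Theta 1 T) << DVar >>%R;
  theta_succ : forall T : nctree 2,
    edges T = [fset (0, 2); (0, 1)]%fset ->
    dend_eq 2 (Theta 2 T) << DSucc DVar DVar >>%R;
  theta_prec : forall T : nctree 2,
    edges T = [fset (0, 2); (1, 2)]%fset ->
    dend_eq 2 (Theta 2 T) << DPrec DVar DVar >>%R;
  theta_sum : forall T : nctree 2,
    edges T = [fset (0, 1); (1, 2)]%fset ->
    dend_eq 2 (Theta 2 T) (<< DPrec DVar DVar >> + << DSucc DVar DVar >>)%R;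
  theta_comp : forall m k i (f : nctree m) (g : nctree k)
      (h : nctree (m + k).-1),
    (0 < i <= m)%N -> (0 < k)%N ->
    (i.-1, i) \in edges f \/ (0, k) \in edges g ->
    edges h = nc_glue f i k g ->
    dend_eq (m + k).-1 (Theta (m + k).-1 h) (dcomp (Theta m f) i (Theta k g))
}.

(* Main.v *)
Require Import Defs.
From mathcomp Require Import zify.

Set Implicit Arguments.
Unset Strict Implicit.
Unset Printing Implicit Defensive.

Import GRing.Theory.

(** A noncrossing tree is built recursively from a single vertex: the longest
    edge at the leftmost vertex of the polygon, the arch, encloses two disjoint
    noncrossing trees A and B, one at each of its ends, and a third tree R
    starts at its right end.  In this decomposition, with sizes a, b and r:

    - the arch has label a + 1, which lies above all the labels of A and B, and
      the labels of R are unrelated to the others; so the poset of T is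
      obtained from those of A, B and R by putting a new element between A and
      B, above both, and placing R beside the result;
    - glueing A, B and R onto noncrossing trees in triangles shows that the
      image of T in the dendriform operad is (t(A) > x < t(B)) * t(R), where
      < and > are the two operations, * is their sum, and t(-) denotes the
      images of the parts, those with a single vertex being omitted
    ([represents_ntsum]).

    A vertex x with left subtree l and right subtree r is the operation
    (l > x) < r, and the dendriform relations expand u * v into the sum,
    without multiplicities, of the trees that split into u and v when cut
    between their first |u| vertices and the others ([dend_prod]).  Cutting is
    monotone for the Tamari order.  The smallest tree that cuts into u and v is
    u grafted on the leftmost leaf of v, and the largest is v grafted on the
    rightmost leaf of u.  Hence a product of intervals is an interval
    ([between_prod]), and the image of T is the sum of an interval whose ends
    [nmin] and [nmax] satisfy the same recursion ([mem_ntrees]).  Grafting on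
    the leftmost leaf creates no decreasing relation between the two factors,
    and grafting on the rightmost leaf creates no increasing one, which
    identifies the relations of the ends with those of T ([nlhd_interval]).

    That the set of trees is determined by the operation needs the linear
    independence of binary trees in the dendriform operad.  It is obtained by
    interpreting the two operations on functions on binary trees, through the
    same cutting maps: all the relations hold there, and the coefficient of a
    given tree can be read off ([hev_ideal], [dend_sum_inj]). *)

(** * Noncrossing trees as ternary trees *)

(** [Pt] is the tree with one vertex, [Arch A B R] the tree whose longest edge
    at the leftmost vertex encloses A (on the left) and B (on the right), with
    R hanging on the right end of that edge. *)
Inductive ntree := Pt | Arch of ntree & ntree & ntree.

Fixpoint nsize t :=
  if t is Arch A B R then (nsize A + nsize B + nsize R).+1 else 0.

(** The leftmost vertex is placed at [d]. *)
Fixpoint nedges t (d : nat) : seq edge :=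
  if t is Arch A B R then
    (d, d + nsize A + (nsize B).+1) ::
    nedges A d ++ nedges B (d + nsize A).+1 ++
    nedges R (d + nsize A + (nsize B).+1)
  else [::].

Lemma nedges_arch A B R d (e : edge) : e \in nedges (Arch A B R) d ->
  [\/ e = (d, d + nsize A + (nsize B).+1), e \in nedges A d,
      e \in nedges B (d + nsize A).+1 |
      e \in nedges R (d + nsize A + (nsize B).+1)].
Proof.
rewrite /= inE !mem_cat => /or4P[/eqP|||] h.
- exact: Or41. - exact: Or42. - exact: Or43. - exact: Or44.
Qed.

(** Noncrossing trees on the vertices p, ..., q.  Connectedness and acyclicity
    are expressed by two-colourings of the vertices: every colouring compatible
    with the edges is constant, and every edge is a bridge, which some
    colouring compatible with all the other edges detects.  Connectedness passes
    from a tree to its parts, and the bridge condition from the parts to the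
    tree, by composing colourings with a retraction. *)
Record nc_on (p q : nat) (E : pred edge) : Prop := NcOn {
  nc_bound : forall e, E e -> p <= e.1 < e.2 /\ e.2 <= q;
  nc_cross : forall e f, E e -> E f -> ~ (e.1 < f.1 < e.2 /\ e.2 < f.2);
  nc_conn : forall f : nat -> bool, (forall e, E e -> f e.1 = f e.2) ->
    forall x, p <= x <= q -> f x = f p;
  nc_bridge : forall e, E e -> exists2 f : nat -> bool,
    forall e', E e' -> e' <> e -> f e'.1 = f e'.2 & f e.1 <> f e.2
}.

Lemma nedges_bound t d (e : edge) :
  e \in nedges t d -> d <= e.1 < e.2 /\ e.2 <= d + nsize t.
Proof.
elim: t d e => [|A IA B IB R IR] d e //=.
rewrite inE !mem_cat => /or4P[/eqP->|/IA|/IB|/IR] /=; lia.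
Qed.

(** A colouring that detects an edge inside one of the three parts is extended
    to the whole tree by the retraction that sends the other vertices to the
    point where they are attached. *)
Lemma nedges_nc_on t d : nc_on d (d + nsize t) (mem (nedges t d)).
Proof.
elim: t d => [|A IA B IB R IR] d.
  split=> //= f _ x; rewrite addn0 => hx.
  by have -> : x = d by lia.
have [bA cA kA rA] := IA d.
have [bB cB kB rB] := IB (d + nsize A).+1.
have [bR cR kR rR] := IR (d + nsize A + (nsize B).+1).
set t := Arch A B R.
have inP := @nedges_arch A B R d.
have inA e : e \in nedges A d -> e \in nedges t d.
  by rewrite /= inE !mem_cat => ->; rewrite orbT.
have inB e : e \in nedges B (d + nsize A).+1 -> e \in nedges t d.
  by rewrite /= inE !mem_cat => ->; rewrite !orbT.
have inR e : e \in nedges R (d + nsize A + (nsize B).+1) -> e \in nedges t d.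
  by rewrite /= inE !mem_cat => ->; rewrite !orbT.
split.
- by move=> e /nedges_bound.
{ move=> e f /inP[->|eA|eB|eR] /inP[->|fA|fB|fR] /=.
  all: try (by apply: cA); try (by apply: cB); try (by apply: cR).
  all: try (have := bA _ eA); try (have := bB _ eB); try (have := bR _ eR).
  all: try (have := bA _ fA); try (have := bB _ fB); try (have := bR _ fR).
  all: rewrite /=; lia. }
- move=> f hf x hx.
  have hA := kA f (fun e h => hf e (inA e h)).
  have hB := kB f (fun e h => hf e (inB e h)).
  have hR := kR f (fun e h => hf e (inR e h)).
  have h0 : f d = f (d + nsize A + (nsize B).+1).
    by apply: (hf (d, d + nsize A + (nsize B).+1)); rewrite /= inE eqxx.
  case: (leqP x (d + nsize A)) => h1; first by apply: hA; lia.
  case: (leqP x (d + nsize A + (nsize B).+1)) => h2; last first.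
    by rewrite h0; apply: hR; move: hx => /=; lia.
  rewrite h0 (hB x); last lia.
  by rewrite (hB (_ + _.+1)) //; lia.
- move=> e /inP[->|eA|eB|eR].
  + exists (fun x => x <= d + nsize A) => /=; last lia.
    move=> e' /inP[-> //|h _|h _|h _].
    * have := bA _ h; lia.
    * have := bB _ h; lia.
    * have := bR _ h; lia.
  + have [f hf fe] := rA e eA.
    exists (fun x => f (if x <= d + nsize A then x else d)); last first.
      have := bA _ eA => he.
      have -> : e.1 <= d + nsize A by lia.
      by have -> : e.2 <= d + nsize A by lia.
    move=> e' /inP[-> _|h ne|h _|h _].
    * by rewrite /= leq_addr; case: ifP => //; lia.
    * have := bA _ h => he.
      have -> : e'.1 <= d + nsize A by lia.
      have -> : e'.2 <= d + nsize A by lia.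
      exact: hf.
    * have := bB _ h => he; do 2![case: ifP => //; try lia].
    * have := bR _ h => he; do 2![case: ifP => //; try lia].
  + have [f hf fe] := rB e eB.
    set m := d + nsize A + (nsize B).+1.
    exists (fun x => f (if d + nsize A < x <= m then x else m)); last first.
      have := bB _ eB => he.
      have -> : d + nsize A < e.1 <= m by lia.
      by have -> : d + nsize A < e.2 <= m by lia.
    move=> e' /inP[-> _|h _|h ne|h _].
    * by rewrite /= ; do 2![case: ifP => //; try lia].
    * have := bA _ h => he; do 2![case: ifP => //; try lia].
    * have := bB _ h => he.
      have -> : d + nsize A < e'.1 <= m by lia.
      have -> : d + nsize A < e'.2 <= m by lia.
      exact: hf.
    * have := bR _ h => he.
      have -> : d + nsize A < e'.2 <= m = false by lia.
      case: ifP => // h1; congr f; lia.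
  + have [f hf fe] := rR e eR.
    set m := d + nsize A + (nsize B).+1.
    exists (fun x => f (maxn m x)); last first.
      have := bR _ eR => he.
      have -> : maxn m e.1 = e.1 by lia.
      by have -> : maxn m e.2 = e.2 by lia.
    move=> e' /inP[-> _|h _|h _|h ne].
    * congr f => /=; lia.
    * have := bA _ h => he; congr f; lia.
    * have := bB _ h => he; congr f; lia.
    * have := bR _ h => he.
      have -> : maxn m e'.1 = e'.1 by lia.
      have -> : maxn m e'.2 = e'.2 by lia.
      exact: hf.
Qed.

Definition within p q (E : pred edge) : pred edge :=
  fun e => [&& E e, p <= e.1 & e.2 <= q].

(** [r] is a retraction onto p', ..., q' that contracts every edge it does not
    keep. *)
Lemma nc_within p q E p' q' (r : nat -> nat) : nc_on p q E ->
  p <= p' -> p' <= q' -> q' <= q ->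
  (forall x, p' <= x <= q' -> r x = x) ->
  (forall e, E e -> within p' q' E e \/ r e.1 = r e.2) ->
  nc_on p' q' (within p' q' E).
Proof.
move=> [bE cE kE rE] hp hpq hq hr hc; split.
- by move=> e /and3P[/bE]; lia.
- by move=> e f /and3P[he _ _] /and3P[hf _ _]; apply: cE.
- move=> f hf.
  have H : forall e, E e -> f (r e.1) = f (r e.2).
    move=> e Ee; case: (hc e Ee) => [he|-> //].
    have := bE e Ee; case/and3P: (he) => _ h1 h2 h3.
    rewrite !hr; [exact: hf | lia | lia].
  have K := kE (f \o r) H.
  move=> x hx.
  have := K x; rewrite /= (hr x) // => ->; last lia.
  have := K p'; rewrite /= (hr p') // => [->//|]; lia.
- move=> e /and3P[Ee _ _]; have [f hf fe] := rE e Ee; exists f => // e'.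
  by case/and3P=> h _ _; apply: hf.
Qed.

(** If every gap between consecutive vertices is covered by an edge, walking
    greedily from p along the longest edges leads to m: by noncrossingness an
    edge that covers the gap to the right of a vertex reached in this way has
    to start at that vertex. *)
Lemma covered_linked p m (E : pred edge) (f : nat -> bool) :
  (forall e, E e -> p <= e.1 < e.2 /\ e.2 <= m) ->
  (forall e g, E e -> E g -> ~ (e.1 < g.1 < e.2 /\ e.2 < g.2)) ->
  (forall e, E e -> f e.1 = f e.2) ->
  (forall k, p <= k < m -> exists2 e, E e & e.1 <= k < e.2) ->
  p <= m -> f p = f m.
Proof.
move=> bE cE iE hk hpm.
have H n x : m - x <= n -> p <= x <= m ->
   (forall e, E e -> ~ e.1 < x < e.2) -> f x = f p -> f m = f p.
  elim: n x => [|n IH] x hn hx exx fx; first by have -> : m = x by lia.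
  case: (ltnP x m) => hxm; last by have -> : m = x by lia.
  have [[u v] /= Euv huv] := hk x ltac:(lia).
  have hu : u = x by have := exx _ Euv; rewrite /=; lia.
  subst u.
  have hex : exists v, E (x, v) by exists v.
  have hb v' : E (x, v') -> v' <= m by move/bE => /=; lia.
  case: (ex_maxnP hex hb) => w Ew hw.
  have := bE _ Ew => /= hxw.
  apply: (IH w); try lia; last by rewrite -(iE _ Ew).
  move=> [a b] Eab /= hab.
  have := exx _ Eab; rewrite /= => h1.
  have := cE _ _ Ew Eab; rewrite /= => h2.
  have h3 : a = x by lia.
  by subst a; have := hw _ Eab; lia.
by symmetry; apply: (H (m - p) p) => //; [lia|move=> e /bE; lia].
Qed.

(** The bound q makes the search finite, so that covering is decidable. *)
Definition covers q (E : pred edge) k : bool :=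
  has (fun e : edge => E e && (e.1 <= k < e.2))
    [seq (x, y) | x <- iota 0 q.+1, y <- iota 0 q.+1].

Lemma coversP p q (E : pred edge) k :
  (forall e, E e -> p <= e.1 < e.2 /\ e.2 <= q) ->
  reflect (exists2 e, E e & e.1 <= k < e.2) (covers q E k).
Proof.
move=> bE; apply: (iffP hasP) => [[e _ /andP[]]|[e Ee hk]]; first by exists e.
exists e; last by rewrite Ee.
case: e Ee {hk} => x y /bE bxy.
by apply: allpairs_f; rewrite mem_iota; move: bxy => /=; lia.
Qed.

(** Otherwise the colouring by the two sides of the gap would contradict
    connectedness. *)
Lemma nc_covered p q E k : nc_on p q E -> p <= k < q ->
  exists2 e, E e & e.1 <= k < e.2.
Proof.
move=> [bE _ kE _] hk.
case: (coversP k bE) => // h.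
have : (q <= k) = (p <= k); last lia.
apply: (kE (fun x => x <= k)); last lia.
move=> e Ee /=; have := bE e Ee.
have [h1|] := boolP (e.1 <= k < e.2); last lia.
by case: h; exists e.
Qed.

(** The vertex m is the far end of the longest edge at p.  Once this edge is
    removed, its ends are no longer linked, so by [covered_linked] some gap
    below it is covered by no remaining edge: the tree separates there. *)
Lemma nc_split p q E : nc_on p q E -> p < q -> exists a m,
  [/\ p <= a, a < m, m <= q & E (p, m)] /\
  [/\ nc_on p a (within p a E), nc_on a.+1 m (within a.+1 m E),
      nc_on m q (within m q E) &
      forall e, E e -> [|| e == (p, m), within p a E e, within a.+1 m E e
                          | within m q E e]].
Proof.
move=> hE hpq; have [bE cE kE rE] := hE.
have [[u v] /= Euv huv] := nc_covered hE (k := p) ltac:(lia).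
have hu : u = p by have := bE _ Euv; rewrite /=; lia.
subst u.
have hex : exists v, E (p, v) by exists v.
have hb v' : E (p, v') -> v' <= q by move/bE => /=; lia.
case: (ex_maxnP hex hb) => m Em hm {v Euv huv hex hb}.
have /= bm := bE _ Em.
have side e : E e -> e.2 <= m \/ m <= e.1.
  case: e => x y Exy /=; have /= := bE _ Exy.
  have := cE _ _ Em Exy; rewrite /=.
  have [xp|] := eqVneq x p; last lia.
  by subst x; have := hm y Exy; lia.
pose E' : pred edge := fun e => [&& E e, e.2 <= m & e != (p, m)].
have [f hf fpm] := rE _ Em.
have [k hk hcut] : exists2 k, p <= k < m &
    forall e, E' e -> e.1 <= k < e.2 -> False.
  have bE' e : E' e -> p <= e.1 < e.2 /\ e.2 <= m.
    by case/and3P=> /bE; lia.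
  have [/allP h|] := boolP (all (covers m E') (iota p (m - p))).
    case: fpm; apply: (@covered_linked p m E' f) => /=.
    - exact: bE'.
    - by move=> e g /and3P[h1 _ _] /and3P[h2 _ _]; apply: cE.
    - by move=> e /and3P[h1 _ /eqP]; apply: hf.
    - by move=> k hk; apply/(coversP _ bE')/h; rewrite mem_iota; lia.
    - lia.
  case/allPn => k; rewrite mem_iota => hk /(coversP _ bE') nk.
  by exists k => [|e Ee he]; [lia | apply: nk; exists e].
have parts e : E e -> [|| e == (p, m), within p k E e, within k.+1 m E e
                          | within m q E e].
  move=> Ee; have := bE e Ee; have := side e Ee.
  have := hcut e; rewrite /E' /within Ee /=.
  by case: (e == (p, m)); rewrite //= andbT; lia.
exists k, m; split; first by split=> //; lia.
have pts e : E e -> [\/ e = (p, m), within p k E e, within k.+1 m E e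
                          | within m q E e].
  move/parts/or4P => [/eqP ?|?|?|?];
   [exact: Or41|exact: Or42|exact: Or43|exact: Or44].
split=> //.
- apply: (@nc_within p q E p k (fun x => if x <= k then x else p) hE); try lia.
    by move=> x hx; case: ifP; lia.
  move=> e /pts[->|?|/and3P[/bE h h1 h2]|/and3P[/bE h h1 h2]] /=; auto; right;
  do 2![case: ifP => //; try lia].
- apply: (@nc_within p q E k.+1 m (fun x => if k < x <= m then x else m) hE);
    try lia.
    by move=> x hx; case: ifP; lia.
  move=> e /pts[->|/and3P[/bE h h1 h2]|?|/and3P[/bE h h1 h2]] /=; auto; right;
  do 2![case: ifP => //; try lia].
- apply: (@nc_within p q E m q (fun x => maxn m x) hE); try lia.
  move=> e /pts[->|/and3P[/bE h h1 h2]|/and3P[/bE h h1 h2]|?] /=; auto; right; lia.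
Qed.

Lemma nc_on_nedges n p q E : q - p = n -> p <= q -> nc_on p q E ->
  exists2 t, p + nsize t = q & forall e : edge, E e = (e \in nedges t p).
Proof.
have [N] := ubnP n; elim: N n p q E => // N IH n p q E hN hn hpq hE.
have [hpq'|hpq'] := leqP q p.
  exists Pt => /=; first lia.
  by move=> e; apply/negP => /(nc_bound hE); lia.
have [a [m [[h1 h2 h3 Em] [hA hB hR parts]]]] := nc_split hE hpq'.
have [A sA eA] := IH (a - p) p a _ ltac:(lia) erefl h1 hA.
have [B sB eB] := IH (m - a.+1) a.+1 m _ ltac:(lia) erefl h2 hB.
have [R sR eR] := IH (q - m) m q _ ltac:(lia) erefl h3 hR.
exists (Arch A B R) => [|e] /=; first lia.
have -> : p + nsize A = a by lia.
have -> : a + (nsize B).+1 = m by lia.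
rewrite inE !mem_cat -eA -eB -eR.
apply/idP/idP; first exact: parts.
by case/or4P => [/eqP->|/and3P[]|/and3P[]|/and3P[]].
Qed.

Lemma adj_sym n (F : {fset edge}) : symmetric (@adj n F).
Proof. by move=> x y; rewrite /adj orbC. Qed.

(** For a bridge the colouring is the connected component of one end in the
    graph without the edge; a path joining the two ends there would close into
    a cycle of length at least 3. *)
Lemma nct_nc_on n E : noncrossing_tree n E -> nc_on 0 n (mem E).
Proof.
case=> bE0 cE kE aE.
have bE (e : edge) : e \in E -> e.1 < e.2 <= n by exact: bE0.
split.
- by move=> e /bE; lia.
- by move=> e f he hf [/andP[h1 h2] h3]; apply: (cE e f he hf).
- move=> f hf x hx.
  have fadj (y z : 'I_n.+1) : adj E y z -> f y = f z.
    by case/orP => /hf /=.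
  have fcon (y z : 'I_n.+1) : connect (@adj n E) y z -> f y = f z.
    case/connectP => p; elim: p y => [|w p IH] y /= => [_ ->//|/andP[/fadj -> hp]].
    exact: IH.
  have := fcon (inord x) ord0 (kE _ _); rewrite inordK //; lia.
- move=> e Ee; have be := bE e Ee.
  pose D := (E `\ e)%fset.
  have Dsym := sym_connect_sym (@adj_sym n D).
  exists (fun v => connect (@adj n D) (inord e.1) (inord v)).
    move=> e' Ee' ne; apply: (same_connect_r Dsym).
    apply: connect1; rewrite /adj /= !inordK; have := bE e' Ee'; try lia.
    move=> _; rewrite -surjective_pairing !inE [e' \in E]Ee' andbT.
    by apply/orP; left; apply/eqP.
  rewrite connect0 => /esym /connectP[p0].
  move/shortenP => [p hp up _ hl].
  have xx : inord e.1 <> inord e.2 :> 'I_n.+1.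
    by move/(congr1 val); rewrite /= !inordK; lia.
  have eD (a b : 'I_n.+1) : adj D a b -> adj E a b.
    by rewrite /adj !inE => /orP[] /andP[_ ->]; rewrite ?orbT.
  suff : size (inord e.1 :: p) <= 2.
    case: p hp up hl => [|b [|//]] /=; first by move=> _ _ /esym.
    move=> + _ hb; rewrite -hb andbT => /orP[].
      by rewrite /= !inordK -?surjective_pairing ?inE ?eqxx //; lia.
    by rewrite !inE => /andP[_ /bE]; rewrite /= !inordK; lia.
  apply: (aE (inord e.1 :: p)) => //.
  rewrite /= rcons_path (sub_path eD hp) -hl /adj /= !inordK; try lia.
  by rewrite -!surjective_pairing [e \in E]Ee orbT.
Qed.

(** In a cycle of length at least 3, a colouring that detects the first edge
    would be constant along the rest of the cycle, whose ends are those of that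
    edge. *)
Lemma nc_on_nct n (E : {fset edge}) : nc_on 0 n (mem E) -> noncrossing_tree n E.
Proof.
case=> bE cE kE rE; split.
- by move=> e /bE [/andP[_ -> ->]].
- by move=> e f he hf [h1 h2 h3]; apply: (cE e f he hf); rewrite h1 h2.
- have Esym := sym_connect_sym (@adj_sym n E).
  have H (x : 'I_n.+1) : connect (@adj n E) ord0 x.
    have := kE (fun v => connect (@adj n E) ord0 (inord v)) _ x.
    rewrite inord_val => ->; last by have := ltn_ord x; lia.
      have -> : inord 0 = ord0 :> 'I_n.+1 by apply: val_inj; rewrite /= inordK.
      exact: connect0.
    move=> e Ee; apply: (same_connect_r Esym); apply: connect1.
    have be := bE e Ee.
    by rewrite /adj /= !inordK -?surjective_pairing ?[e \in E]Ee //; lia.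
  by move=> x y; apply: connect_trans (H y); rewrite Esym.
- move=> [|x [|y [|z p]]] //= /andP[axy /andP[ayz hp]] /andP[nx /andP[ny _]].
  move: nx ny; rewrite !inE !negb_or => /andP[nxy /andP[nxz nxp]] /andP[nyz nyp].
  have [e [Ee he]] : exists e, e \in E /\
      (e = (val x, val y) \/ e = (val y, val x)).
    by case/orP: axy => h; [exists (val x, val y)|exists (val y, val x)]; auto.
  have [f hf fe] := rE e Ee.
  have fadj (a b : 'I_n.+1) : adj E a b ->
     (a != x) && (a != y) || (b != x) && (b != y) -> f a = f b.
    move=> hab ne.
    have neq : (val a, val b) <> e /\ (val b, val a) <> e.
      case: he => ->; split; case => /val_inj ? /val_inj ?; subst;
        by rewrite !eqxx /= ?andbF in ne.
    case/orP: hab => h; first exact: (hf _ h neq.1).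
    by symmetry; apply: (hf _ h neq.2).
  have fp w : last z p = w -> f z = f w.
    move: hp nxz nxp nyz nyp; rewrite rcons_path => /andP[hp _].
    elim: p z hp {ayz} => [|v p IH] z /=; first by move=> _ _ _ _ _ ->.
    case/andP=> zv hp zx; rewrite inE negb_or => /andP[vx px] zy.
    rewrite inE negb_or => /andP[vy py] hw.
    rewrite (fadj _ _ zv) ?IH // 1?eq_sym zx 1?eq_sym zy //.
  have f1 : f y = f z by apply: fadj ayz _; rewrite ![z == _]eq_sym nxz nyz orbT.
  have f2 : f (last z p) = f x.
    apply: fadj; first by move: hp; rewrite rcons_path => /andP[].
    have : last z p \in z :: p by apply: mem_last.
    rewrite inE => hl; apply/orP; left; apply/andP; split; apply/eqP => hh.
      by move: hl; rewrite hh (negPf nxz) (negPf nxp).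
    by move: hl; rewrite hh (negPf nyz) (negPf nyp).
  by have := fp _ erefl; case: he fe => -> /= fe h; case: fe; rewrite f1 h f2.
Qed.

Definition nfset t : {fset edge} := [fset e in nedges t 0]%fset.

Lemma in_nfset t (e : edge) : (e \in nfset t) = (e \in nedges t 0).
Proof. by rewrite in_fset. Qed.

Lemma nfset_nct t : noncrossing_tree (nsize t) (nfset t).
Proof.
apply: nc_on_nct; have [b c k r] := nedges_nc_on t 0; split.
- by move=> e; rewrite /= in_nfset => /b.
- by move=> e f; rewrite /= !in_nfset; apply: c.
- by move=> f hf; apply: k => e he; apply: hf; rewrite /= in_nfset.
- move=> e; rewrite /= in_nfset => /r[f h1 h2]; exists f => // e'.
  by rewrite /= in_nfset; apply: h1.
Qed.

Lemma nct_nfset n E : noncrossing_tree n E -> exists2 t, nsize t = n & E = nfset t.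
Proof.
move/nct_nc_on => /(nc_on_nedges erefl (leq0n n)) [t st Et].
by exists t => //; apply/fsetP => e; rewrite in_nfset -Et.
Qed.

(** * The order on the labels of a noncrossing tree *)

(** The edges with their labels: the label of the arch is the only side below
    it that lies neither under A nor under B. *)
Fixpoint nlab t (d : nat) : seq (edge * nat) :=
  if t is Arch A B R then
    ((d, d + nsize A + (nsize B).+1), (d + nsize A).+1) ::
    nlab A d ++ nlab B (d + nsize A).+1 ++
    nlab R (d + nsize A + (nsize B).+1)
  else [::].

Lemma nlab_arch A B R d (e : edge) (i : nat) : (e, i) \in nlab (Arch A B R) d ->
  [\/ e = (d, d + nsize A + (nsize B).+1) /\ i = (d + nsize A).+1,
      (e, i) \in nlab A d, (e, i) \in nlab B (d + nsize A).+1 |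
      (e, i) \in nlab R (d + nsize A + (nsize B).+1)].
Proof.
rewrite /= inE !mem_cat => /or4P[/eqP[]|||] h.
- by move=> ->; apply: Or41. - exact: Or42. - exact: Or43. - exact: Or44.
Qed.

Lemma nedges_cover t d i : d < i <= d + nsize t ->
  exists2 f : edge, f \in nedges t d & f.1 < i <= f.2.
Proof.
elim: t d => [|A _ B _ R IR] d /= hi; first lia.
have [h|h] := leqP i (d + nsize A + (nsize B).+1).
  by exists (d, d + nsize A + (nsize B).+1); rewrite ?inE ?eqxx //=; lia.
have [|f hf hif] := IR (d + nsize A + (nsize B).+1); first lia.
by exists f => //; rewrite inE !mem_cat hf !orbT.
Qed.

Lemma nlab_edge t d (e : edge) (i : nat) : (e, i) \in nlab t d -> e \in nedges t d.
Proof.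
elim: t d => [//|A IA B IB R IR] d /nlab_arch[[-> _]|/IA|/IB|/IR] /=;
  rewrite inE !mem_cat ?eqxx // => ->; rewrite ?orbT //.
Qed.

Lemma nlab_bound t d (e : edge) (i : nat) : (e, i) \in nlab t d -> e.1 < i <= e.2.
Proof.
by elim: t d => [//|A IA B IB R IR] d /nlab_arch[[-> ->]|/IA|/IB|/IR] //=; lia.
Qed.

(** The sides covered by the edges of A are exactly those below A, and likewise
    for B, so the arch keeps the gap between them; edges in different parts do
    not interfere. *)
Lemma nlabP t d (e : edge) (i : nat) : (e, i) \in nlab t d <->
  [/\ e \in nedges t d, e.1 < i <= e.2 &
    forall f : edge, f \in nedges t d -> f <> e -> e.1 <= f.1 -> f.2 <= e.2 ->
      ~ f.1 < i <= f.2].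
Proof.
split.
{ move=> h; split; [exact: nlab_edge h|exact: nlab_bound h|].
  elim: t d h => [//|A IA B IB R IR] d.
  case/nlab_arch=> [[-> ->]|he|he|he] f /nedges_arch[->|hf|hf|hf] ne //=.
  all: try (by apply: (IA _ he)); try (by apply: (IB _ he));
       try (by apply: (IR _ he)).
  all: try have := nedges_bound (nlab_edge he).
  all: try have := nedges_bound hf.
  all: rewrite /=; lia. }
case; elim: t d => [//|A IA B IB R IR] d /nedges_arch[->|he|he|he] hi hf.
all: rewrite inE !mem_cat.
- have [h|] := boolP (d < i <= d + nsize A).
    have [f hfA hif] := nedges_cover h.
    have bf := nedges_bound hfA.
    exfalso; apply: (hf f) hif => /=; try lia.
      by rewrite inE !mem_cat hfA orbT.
    by move=> ef; move: bf; rewrite ef /=; lia.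
  have [h|] := boolP ((d + nsize A).+1 < i <= (d + nsize A).+1 + nsize B).
    have [f hfA hif] := nedges_cover h.
    have bf := nedges_bound hfA.
    exfalso; apply: (hf f) hif => /=; try lia.
      by rewrite inE !mem_cat hfA !orbT.
    by move=> ef; move: bf; rewrite ef /=; lia.
  move: hi => /= hi h1 h2.
  have -> : i = (d + nsize A).+1 by lia.
  by rewrite eqxx.
- rewrite IA ?orbT // => f h; apply: hf; by rewrite inE !mem_cat h orbT.
- rewrite IB ?orbT // => f h; apply: hf; by rewrite inE !mem_cat h !orbT.
- rewrite IR ?orbT // => f h; apply: hf; by rewrite inE !mem_cat h !orbT.
Qed.

Lemma nlab_exists t d i : d < i <= d + nsize t ->
  exists e : edge, (e, i) \in nlab t d.
Proof.
elim: t d => [|A IA B IB R IR] d hi; first by move: hi => /=; lia.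
have [h|hA] := boolP (d < i <= d + nsize A).
  by have [e he] := IA d h; exists e; rewrite inE !mem_cat he orbT.
have [h|hB] := boolP ((d + nsize A).+1 < i <= (d + nsize A).+1 + nsize B).
  by have [e he] := IB _ h; exists e; rewrite inE !mem_cat he !orbT.
have [h|hR] := ltnP (d + nsize A + (nsize B).+1) i.
  have [|e he] := IR (d + nsize A + (nsize B).+1); first by move: hi => /=; lia.
  by exists e; rewrite inE !mem_cat he !orbT.
exists (d, d + nsize A + (nsize B).+1); rewrite inE.
have -> : i = (d + nsize A).+1 by move: hi => /=; lia.
by rewrite eqxx.
Qed.

(** The first clause puts labels below the one of the arch; the three others
    never relate labels of different parts. *)
Fixpoint nlhd t (d i j : nat) : bool :=
  if t is Arch A B R then
    [|| (j == (d + nsize A).+1) && (d < i <= d + nsize A + (nsize B).+1),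
      nlhd A d i j, nlhd B (d + nsize A).+1 i j |
      nlhd R (d + nsize A + (nsize B).+1) i j]
  else false.

Lemma nlhd_bound t d i j : nlhd t d i j ->
  d < i <= d + nsize t /\ d < j <= d + nsize t.
Proof.
elim: t d => [//|A IA B IB R IR] d /= /or4P[|/IA|/IB|/IR]; lia.
Qed.

Lemma nlhdP t d i j : nlhd t d i j <->
  exists e f : edge, [/\ (e, i) \in nlab t d, (f, j) \in nlab t d,
                  f.1 <= e.1 & e.2 <= f.2].
Proof.
elim: t d => [|A IA B IB R IR] d; first by split=> // -[e [f []]].
split.
  case/or4P=> [/andP[/eqP-> hi]|/IA|/IB|/IR].
  - have [e he] := @nlab_exists (Arch A B Pt) d i ltac:(rewrite /=; lia).
    have be := nedges_bound (nlab_edge he).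
    exists e, (d, d + nsize A + (nsize B).+1); split => /=; rewrite ?inE ?eqxx //.
    + move: he; rewrite inE !mem_cat => /or4P[->|->|->|//]; by rewrite ?orbT.
    + lia.
    + move: be => /=; lia.
  - move=> [e [f [h1 h2 h3 h4]]]; exists e, f; split=> //;
      by rewrite inE !mem_cat (h1, h2) ?orbT.
  - move=> [e [f [h1 h2 h3 h4]]]; exists e, f; split=> //;
      by rewrite inE !mem_cat (h1, h2) ?orbT.
  - move=> [e [f [h1 h2 h3 h4]]]; exists e, f; split=> //;
      by rewrite inE !mem_cat (h1, h2) ?orbT.
case=> e [f [/nlab_arch he /nlab_arch hf h1 h2]] /=.
case: hf => [[ef ej]|hf|hf|hf].
- subst f j; rewrite eqxx /=.
  case: he => [[ee ei]|he|he|he].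
  + subst; by apply/orP; left; lia.
  + have := nedges_bound (nlab_edge he); have := nlab_bound he.
    move=> ? ?; apply/orP; left; move: h1 h2 => /=; lia.
  + have := nedges_bound (nlab_edge he); have := nlab_bound he.
    move=> ? ?; apply/orP; left; move: h1 h2 => /=; lia.
  + have := nedges_bound (nlab_edge he); have := nlab_bound he.
    move=> ? ?; apply/orP; left; move: h1 h2 => /=; lia.
- have -> : nlhd A d i j.
    apply/IA; exists e, f; split=> //.
    have bf := nedges_bound (nlab_edge hf).
    case: he => [[ee ei]|//|he|he]; first by subst e; move: h2 => /=; lia.
      have := nedges_bound (nlab_edge he); lia.
    have := nedges_bound (nlab_edge he); lia.
  by rewrite orbT.
- have -> : nlhd B (d + nsize A).+1 i j.
    apply/IB; exists e, f; split=> //.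
    have bf := nedges_bound (nlab_edge hf).
    case: he => [[ee ei]|he|//|he]; first by subst e; move: h1 => /=; lia.
      have := nedges_bound (nlab_edge he); lia.
    have := nedges_bound (nlab_edge he); lia.
  by rewrite !orbT.
- have -> : nlhd R (d + nsize A + (nsize B).+1) i j.
    apply/IR; exists e, f; split=> //.
    have bf := nedges_bound (nlab_edge hf).
    case: he => [[ee ei]|he|he|//]; first by subst e; move: h1 => /=; lia.
      have := nedges_bound (nlab_edge he); lia.
    have := nedges_bound (nlab_edge he); lia.
  by rewrite !orbT.
Qed.

Lemma edge_labelP t (e : edge) (i : nat) :
  e \in nfset t /\ edge_label (nfset t) e i <-> (e, i) \in nlab t 0.
Proof.
rewrite nlabP; split.
  rewrite in_nfset => -[he [hi hf]]; split=> // f hfe.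
  by apply: hf; rewrite in_nfset.
rewrite in_nfset => -[he hi hf]; split=> //; split=> // f.
by rewrite in_nfset; apply: hf.
Qed.

Lemma nct_lhdP t i j : nct_lhd (nfset t) i j <-> nlhd t 0 i j.
Proof.
rewrite nlhdP; split.
  case=> e [f [he hf hi hj [h1 h2]]]; exists e, f; split=> //;
    exact/edge_labelP.
case=> e [f [/edge_labelP[he hi] /edge_labelP[hf hj] h1 h2]].
by exists e, f; split.
Qed.

Lemma nlhd_interval_poset t : interval_poset (nsize t) (nlhd t 0).
Proof.
split.
- by move=> i j /nlhd_bound; rewrite add0n.
- move=> i hi; apply/nlhdP.
  by have [e he] := @nlab_exists t 0 i hi; exists e, e.
{ elim: t 0 => [//|A IA B IB R IR] d i j /= /or4P[h|h|h|h] /or4P[h'|h'|h'|h'].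
  all: try (by apply: IA h h'); try (by apply: IB h h'); try (by apply: IR h h').
  all: try have := nlhd_bound h.
  all: try have := nlhd_bound h'.
  all: lia. }
{ elim: t 0 => [//|A IA B IB R IR] d i j k /= /or4P[h|h|h|h] /or4P[h'|h'|h'|h'].
  all: try (by rewrite (IA _ _ _ _ h h') ?orbT);
    try (by rewrite (IB _ _ _ _ h h') ?orbT);
    try (by rewrite (IR _ _ _ _ h h') ?orbT).
  all: try have := nlhd_bound h.
  all: try have := nlhd_bound h'.
  all: lia. }
{ elim: t 0 => [//|A IA B IB R IR] d a b c hab /= /or4P[h|h|h|h].
  all: try (by rewrite (IA _ _ _ _ hab h) ?orbT);
    try (by rewrite (IB _ _ _ _ hab h) ?orbT);
    try (by rewrite (IR _ _ _ _ hab h) ?orbT).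
  lia. }
{ elim: t 0 => [//|A IA B IB R IR] d a b c hab /= /or4P[h|h|h|h].
  all: try (by rewrite (IA _ _ _ _ hab h) ?orbT);
    try (by rewrite (IB _ _ _ _ hab h) ?orbT);
    try (by rewrite (IR _ _ _ _ hab h) ?orbT).
  lia. }
Qed.

(** The edges that separate a given edge from the base are nested. *)
Lemma nlhd_chain t d i j k : nlhd t d i j -> nlhd t d i k ->
  nlhd t d j k || nlhd t d k j.
Proof.
elim: t d => [//|A IA B IB R IR] d /= /or4P[h|h|h|h] /or4P[h'|h'|h'|h'].
all: try (by case/orP: (IA _ h h') => ->; rewrite ?orbT);
    try (by case/orP: (IB _ h h') => ->; rewrite ?orbT);
    try (by case/orP: (IR _ h h') => ->; rewrite ?orbT).
all: try have := nlhd_bound h.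
all: try have := nlhd_bound h'.
all: lia.
Qed.

(** By [nlhd_chain] the elements above y form a chain, so y is covered by at
    most one element. *)
Lemma nlhd_exceptional t : exceptional (nlhd t 0).
Proof.
case=> x [y [z [hxyz [h1 _ h2] [h3 _ h4]]]].
case/orP: (nlhd_chain h1 h3) => h; first by case: (h4 x h1 h); lia.
by case: (h2 z h3 h); lia.
Qed.

(** * Cutting and multiplying binary trees *)

(** The trees induced on the first p vertices, and on the others, in
    in-order. *)
Fixpoint lcut (p : nat) (t : btree) : btree :=
  if t is BNode l r then
    if p <= bsize l then lcut p l else BNode l (lcut (p - (bsize l).+1) r)
  else BLeaf.

Fixpoint rcut (p : nat) (t : btree) : btree :=
  if t is BNode l r then
    if p <= bsize l then BNode (rcut p l) r else rcut (p - (bsize l).+1) r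
  else BLeaf.

Lemma bsize_lcut p t : bsize (lcut p t) = minn p (bsize t).
Proof.
elim: t p => [|l IHl r IHr] p /=; first lia.
case: ifP => h /=; rewrite ?IHl ?IHr; lia.
Qed.

Lemma bsize_rcut p t : bsize (rcut p t) = bsize t - p.
Proof.
elim: t p => [|l IHl r IHr] p /=; first lia.
case: ifP => h /=; rewrite ?IHl ?IHr; lia.
Qed.

Lemma bsize0 t : bsize t = 0 -> t = BLeaf.
Proof. by case: t. Qed.

Lemma lcut0 t : lcut 0 t = BLeaf.
Proof. by apply: bsize0; rewrite bsize_lcut; lia. Qed.

Lemma rcut0 t : rcut 0 t = t.
Proof. by elim: t => //= l -> r _. Qed.

Lemma lcut_all p t : bsize t <= p -> lcut p t = t.
Proof.
elim: t p => [|l _ r IHr] p //= hp.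
by case: ifP => h; [lia | rewrite IHr //; lia].
Qed.

Lemma rcut_all p t : bsize t <= p -> rcut p t = BLeaf.
Proof. by move=> hp; apply: bsize0; rewrite bsize_rcut; lia. Qed.

Lemma lcut_lcut p q t : p <= q -> lcut p (lcut q t) = lcut p t.
Proof.
elim: t p q => [|l IHl r IHr] p q hpq //=.
case: (leqP q (bsize l)) => hq.
  have -> : p <= bsize l by lia.
  exact: IHl.
rewrite /=; case: ifP => h //; rewrite IHr //; lia.
Qed.

Lemma rcut_lcut p q t : p <= q -> rcut p (lcut q t) = lcut (q - p) (rcut p t).
Proof.
elim: t p q => [|l IHl r IHr] p q hpq //=.
case: (leqP q (bsize l)) => hq.
  have -> : p <= bsize l by lia.
  rewrite IHl //= bsize_rcut.
  by have -> : q - p <= bsize l - p by lia.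
rewrite /=; case: ifP => h /=.
  rewrite bsize_rcut.
  have -> : (q - p <= bsize l - p) = false by lia.
  congr (BNode _ (lcut _ _)); lia.
rewrite IHr; last lia.
congr lcut; lia.
Qed.

Lemma rcut_rcut p q t : p <= q -> rcut (q - p) (rcut p t) = rcut q t.
Proof.
elim: t p q => [|l IHl r IHr] p q hpq //=.
case: (leqP p (bsize l)) => hp /=; last first.
  have -> : (q <= bsize l) = false by lia.
  rewrite -(IHr (p - (bsize l).+1) (q - (bsize l).+1)); last lia.
  congr rcut; lia.
rewrite bsize_rcut leq_sub2rE //.
case: ifP => h; first by rewrite IHl.
congr rcut; lia.
Qed.

(** The number of vertices before the root: it tells on which side of a cut the
    root falls. *)
Definition lsize t := if t is BNode l _ then bsize l else 0.

Lemma lsize_lcut p t : lsize t < p -> lsize (lcut p t) = lsize t.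
Proof. by case: t => //= l r hp; case: ifP => //; lia. Qed.

Lemma lsize_rcut p t : p <= lsize t -> lsize (rcut p t) = lsize t - p.
Proof. by case: t => //= l r hp; rewrite hp /= bsize_rcut. Qed.

(** The product of two trees in the dendriform algebra of binary trees, as a
    list of trees: the root comes either from the first factor or from the
    second. *)
Fixpoint tprod (u : btree) : btree -> seq btree :=
  fix tprod_u v :=
    match u, v with
    | BLeaf, _ => [:: v]
    | _, BLeaf => [:: u]
    | BNode l r, BNode l' r' =>
        [seq BNode l x | x <- tprod r v] ++ [seq BNode y r' | y <- tprod_u l']
    end.

Lemma tprodu0 u : tprod u BLeaf = [:: u].
Proof. by case: u. Qed.

Lemma tprod0v v : tprod BLeaf v = [:: v].
Proof. by case: v. Qed.

Lemma tprodE l r l' r' : tprod (BNode l r) (BNode l' r') =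
  [seq BNode l x | x <- tprod r (BNode l' r')] ++
  [seq BNode y r' | y <- tprod (BNode l r) l'].
Proof. by []. Qed.

Lemma tprod_cut u v t : t \in tprod u v ->
  lcut (bsize u) t = u /\ rcut (bsize u) t = v.
Proof.
elim: u v t => [|l _ r IHr] v t.
  by rewrite tprod0v inE => /eqP->; rewrite lcut0 rcut0.
elim: v t => [|l' IHl' r' _] t.
  by rewrite tprodu0 inE => /eqP->; rewrite lcut_all ?rcut_all.
rewrite tprodE mem_cat => /orP[] /mapP[x hx ->].
  have [h1 h2] := IHr _ _ hx; rewrite /=.
  have -> : ((bsize l + bsize r).+1 <= bsize l) = false by lia.
  have -> : (bsize l + bsize r).+1 - (bsize l).+1 = bsize r by lia.
  by rewrite h1 h2.
have [h1 h2] := IHl' _ hx.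
have hb : bsize (BNode l r) <= bsize x.
  have := congr1 bsize h1; rewrite bsize_lcut; lia.
by rewrite [lcut _ _]/= [rcut _ _]/= hb h1 h2.
Qed.

(** Together with [tprod_cut]: the product of u and v consists of the trees that
    cut into u and v. *)
Lemma cut_tprod p t : t \in tprod (lcut p t) (rcut p t).
Proof.
elim: t p => [|a IHa b IHb] p; first by rewrite inE.
rewrite /=; case: (leqP p (bsize a)) => hp.
  have := IHa p; case: (lcut p a) (rcut p a) => [|l r] v.
    by rewrite tprod0v inE => /eqP->; rewrite inE.
  by move=> h; rewrite tprodE mem_cat (map_f (BNode^~ b)) ?orbT.
have := IHb (p - (bsize a).+1).
case: (rcut _ b) => [|l' r'].
  by rewrite tprodu0 inE => /eqP <-; rewrite inE.
by move=> h; rewrite tprodE mem_cat (map_f (BNode a)).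
Qed.

Lemma tprod_size u v t : t \in tprod u v -> bsize t = bsize u + bsize v.
Proof.
case/tprod_cut=> /(congr1 bsize) + /(congr1 bsize).
rewrite bsize_lcut bsize_rcut; lia.
Qed.

(** The root of a tree of the product tells which of the two halves of the list
    it belongs to: the left subtrees have different sizes. *)
Lemma tprod_uniq u v : uniq (tprod u v).
Proof.
elim: u v => [|l _ r IHr] v; first by rewrite tprod0v.
elim: v => [//|l' IHl' r' _]; rewrite tprodE cat_uniq !map_inj_uniq ?IHr ?IHl' //=;
  try by move=> x y [].
rewrite andbT; apply/hasPn => t /mapP[y _ ->].
apply/mapP => -[x /tprod_size /=+ [_ h]]; rewrite -h; lia.
Qed.

(** * The Tamari order *)

Lemma tam_left l l' r : tam_le l l' -> tam_le (BNode l r) (BNode l' r).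
Proof.
elim=> [x y h|x|x y z _ h1 _ h2]; first by apply/rt_step/TamLeft.
  exact: rt_refl.
exact: rt_trans h1 h2.
Qed.

Lemma tam_right l r r' : tam_le r r' -> tam_le (BNode l r) (BNode l r').
Proof.
elim=> [x y h|x|x y z _ h1 _ h2]; first by apply/rt_step/TamRight.
  exact: rt_refl.
exact: rt_trans h1 h2.
Qed.

Lemma tam_node l l' r r' : tam_le l l' -> tam_le r r' ->
  tam_le (BNode l r) (BNode l' r').
Proof. by move=> h1 h2; apply: rt_trans (tam_left _ h1) (tam_right _ h2). Qed.

Lemma tam_rot a b c : tam_le (BNode (BNode a b) c) (BNode a (BNode b c)).
Proof. exact/rt_step/TamRot. Qed.

Lemma tam_cover_size t t' : tam_cover t t' -> bsize t = bsize t'.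
Proof. elim=> /=; lia. Qed.

Lemma tam_size t t' : tam_le t t' -> bsize t = bsize t'.
Proof. by elim=> [? ? /tam_cover_size|//|? ? ? _ -> _ ->]. Qed.

(** A rotation at the root makes the left subtree smaller, and the others keep
    its size. *)
Lemma tam_lsize t t' : tam_le t t' -> lsize t' <= lsize t.
Proof.
elim=> [x y [] /=|//|x y z _ h1 _ h2]; [lia| |lia|lia].
by move=> l l' _ /tam_cover_size ->.
Qed.

(** A cut either separates the two vertices involved in a rotation, which then
    disappears, or leaves the rotation on one side. *)
Lemma tam_cut_cover p t t' : tam_cover t t' ->
  tam_le (lcut p t) (lcut p t') /\ tam_le (rcut p t) (rcut p t').
Proof.
move=> h; elim: h p => [a b c|l l' r h IH|l r r' h IH] p /=.
- have [h1|h1] := leqP p (bsize a).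
    have -> : p <= (bsize a + bsize b).+1 by lia.
    by split; [exact: rt_refl|exact: tam_rot].
  have [h2|h2] := leqP p (bsize a + bsize b).+1.
    have -> : p - (bsize a).+1 <= bsize b by lia.
    by split; exact: rt_refl.
  have -> : (p - (bsize a).+1 <= bsize b) = false by lia.
  rewrite /=.
  have -> : p - (bsize a).+1 - (bsize b).+1 = p - (bsize a + bsize b).+2 by lia.
  by split; [exact: tam_rot|exact: rt_refl].
- rewrite -(tam_cover_size h); case: ifP => hp; have [h1 h2] := IH p.
    by split=> //; apply: tam_left.
  by split; [apply/tam_left/rt_step|exact: rt_refl].
- case: ifP => hp.
    by split; [exact: rt_refl|apply/tam_right/rt_step].
  by have [h1 h2] := IH (p - (bsize l).+1); split=> //; apply: tam_right.
Qed.

Lemma tam_lcut p t t' : tam_le t t' -> tam_le (lcut p t) (lcut p t').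
Proof.
elim=> [x y /(tam_cut_cover p)[]//|x|x y z _ h1 _ h2]; first exact: rt_refl.
exact: rt_trans h1 h2.
Qed.

Lemma tam_rcut p t t' : tam_le t t' -> tam_le (rcut p t) (rcut p t').
Proof.
elim=> [x y /(tam_cut_cover p)[]//|x|x y z _ h1 _ h2]; first exact: rt_refl.
exact: rt_trans h1 h2.
Qed.

(** Grafting u on the leftmost leaf of v, or v on the rightmost leaf of u: the
    smallest and the largest trees that cut into u and v. *)
Fixpoint over u v := if v is BNode l r then BNode (over u l) r else u.
Fixpoint under u v := if u is BNode l r then BNode l (under r v) else v.

Lemma bsize_over u v : bsize (over u v) = bsize u + bsize v.
Proof. elim: v => [|l IHl r _] /=; lia. Qed.

Lemma bsize_under u v : bsize (under u v) = bsize u + bsize v.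
Proof. elim: u => [|l _ r IHr] /=; lia. Qed.

Lemma lcut_over u v : lcut (bsize u) (over u v) = u.
Proof.
elim: v => [|l IHl r _] /=; first by rewrite lcut_all.
by rewrite bsize_over leq_addr.
Qed.

Lemma rcut_over u v : rcut (bsize u) (over u v) = v.
Proof.
elim: v => [|l IHl r _] /=; first by rewrite rcut_all.
by rewrite bsize_over leq_addr IHl.
Qed.

Lemma lcut_under u v : lcut (bsize u) (under u v) = u.
Proof.
elim: u => [|l _ r IHr] /=; first exact: lcut0.
have -> : ((bsize l + bsize r).+1 <= bsize l) = false by lia.
have -> : (bsize l + bsize r).+1 - (bsize l).+1 = bsize r by lia.
by rewrite IHr.
Qed.

Lemma rcut_under u v : rcut (bsize u) (under u v) = v.
Proof.
elim: u => [|l _ r IHr] /=; first exact: rcut0.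
have -> : ((bsize l + bsize r).+1 <= bsize l) = false by lia.
by have -> : (bsize l + bsize r).+1 - (bsize l).+1 = bsize r by lia.
Qed.

Lemma over_mono u u' v v' : tam_le u u' -> tam_le v v' ->
  tam_le (over u v) (over u' v').
Proof.
move=> hu hv; apply: (@rt_trans _ _ _ (over u v')).
  elim: hv => [x y|x|x y z _ h1 _ h2]; last exact: rt_trans h1 h2.
    by elim=> [a b c|l l' r _ IH|l r r' h _] /=;
      [exact: tam_rot|exact: tam_left|apply/tam_right/rt_step].
  exact: rt_refl.
by elim: v' {hv} => [//|l IHl r _] /=; apply: tam_left.
Qed.

Lemma under_mono u u' v v' : tam_le u u' -> tam_le v v' ->
  tam_le (under u v) (under u' v').
Proof.
move=> hu hv; apply: (@rt_trans _ _ _ (under u' v)).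
  elim: hu => [x y|x|x y z _ h1 _ h2]; last exact: rt_trans h1 h2.
    by elim=> [a b c|l l' r h _|l r r' _ IH] /=;
      [exact: tam_rot|apply/tam_left/rt_step|exact: tam_right].
  exact: rt_refl.
by elim: u' {hu} => [//|l _ r IHr] /=; apply: tam_right.
Qed.

Lemma over_rot l x y : tam_le (over (BNode l x) y) (BNode l (over x y)).
Proof.
elim: y => [|c IHc d _] /=; first exact: rt_refl.
exact: rt_trans (tam_left _ IHc) (tam_rot _ _ _).
Qed.

Lemma under_rot x y r : tam_le (BNode (under x y) r) (under x (BNode y r)).
Proof.
elim: x => [|a _ b IHb] /=; first exact: rt_refl.
exact: rt_trans (tam_rot _ _ _) (tam_right _ IHb).
Qed.

Lemma over_cut_le p t : tam_le (over (lcut p t) (rcut p t)) t.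
Proof.
elim: t p => [|l IHl r IHr] p /=; first exact: rt_refl.
case: ifP => hp /=; first exact: tam_left.
exact: rt_trans (over_rot _ _ _) (tam_right _ (IHr _)).
Qed.

Lemma le_under_cut p t : tam_le t (under (lcut p t) (rcut p t)).
Proof.
elim: t p => [|l IHl r IHr] p /=; first exact: rt_refl.
case: ifP => hp /=; last exact: tam_right.
exact: rt_trans (tam_left _ (IHl _)) (under_rot _ _ _).
Qed.

Definition tam_between (S S' t : btree) := tam_le S t /\ tam_le t S'.

(** Products of intervals are intervals: cutting is monotone, grafting is
    monotone, and a tree lies between the two graftings of its pieces. *)
Lemma between_prod S S' U U' t : bsize S = bsize S' ->
  tam_between (over S U) (under S' U') t <->
  tam_between S S' (lcut (bsize S) t) /\ tam_between U U' (rcut (bsize S) t).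
Proof.
move=> hs; split.
  case=> h1 h2; have [] := (tam_lcut (bsize S) h1, tam_lcut (bsize S) h2).
  have [] := (tam_rcut (bsize S) h1, tam_rcut (bsize S) h2).
  by rewrite lcut_over rcut_over hs lcut_under rcut_under.
case=> [[h1 h2] [h3 h4]]; split.
  exact: rt_trans (over_mono h1 h3) (over_cut_le _ _).
exact: rt_trans (le_under_cut _ _) (under_mono h2 h4).
Qed.

(** The two subtrees are recovered by cutting just before and just after the
    root. *)
Lemma tam_node_inv l r l' r' : bsize l = bsize l' ->
  tam_le (BNode l r) (BNode l' r') -> tam_le l l' /\ tam_le r r'.
Proof.
move=> hl h; split.
  by have := tam_lcut (bsize l) h; rewrite /= -hl leqnn !lcut_all // hl.
have := tam_rcut (bsize l).+1 h; rewrite /= -hl.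
by rewrite ltnn subnn !rcut0.
Qed.

(** The size of the left subtree is monotone, hence constant on the interval.
*)
Lemma between_node S S' U U' t : bsize S = bsize S' ->
  tam_between (BNode S U) (BNode S' U') t <->
  exists l r, [/\ t = BNode l r, tam_between S S' l & tam_between U U' r].
Proof.
move=> hs; split; last first.
  by case=> l [r [-> [h1 h2] [h3 h4]]]; split; apply: tam_node.
case=> h1 h2; have := tam_lsize h1; have := tam_lsize h2.
case: t h1 h2 => [/tam_size//|l r] h1 h2 /= h3 h4.
have hl : bsize l = bsize S by lia.
have [h5 h6] := tam_node_inv (esym hl) h1.
have [h7 h8] := tam_node_inv (etrans hl hs) h2.
by exists l, r.
Qed.

Lemma tree_lhd_bound t i j : tree_lhd t i j ->
  0 < i <= bsize t /\ 0 < j <= bsize t.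
Proof.
elim: t i j => [//|l IHl r IHr] i j /=.
case: eqP => [->|h]; first lia.
case: ltnP => h'; first by move/IHl; lia.
by case/andP=> h1 /IHr; lia.
Qed.

(** Grafting on the leftmost leaf only puts vertices of u below vertices of v,
    which come later: no decreasing relation appears. *)
Lemma tree_lhd_over u v i j : j < i ->
  tree_lhd (over u v) i j = tree_lhd u i j ||
    [&& bsize u < i, bsize u < j & tree_lhd v (i - bsize u) (j - bsize u)].
Proof.
move=> hij; elim: v => [|l IHl r _] /=; first by rewrite !andbF orbF.
have uf : bsize u < j -> tree_lhd u i j = false.
  by move=> h; apply/negP => /tree_lhd_bound; lia.
rewrite bsize_over; case: (ltngtP j (bsize u + bsize l).+1) => h.
- rewrite IHl; case: (ltnP (bsize u) j) => h1; last by rewrite !andbF.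
  have -> : (j - bsize u == (bsize l).+1) = false by lia.
  by have -> : j - bsize u < (bsize l).+1 by lia.
- rewrite uf /=; last lia.
  have -> : (j - bsize u == (bsize l).+1) = false by lia.
  have -> : (j - bsize u < (bsize l).+1) = false by lia.
  have -> : i - (bsize u + bsize l).+1 = i - bsize u - (bsize l).+1 by lia.
  have -> : j - (bsize u + bsize l).+1 = j - bsize u - (bsize l).+1 by lia.
  case: (tree_lhd r _ _); rewrite ?andbF // ?andbT; lia.
- rewrite uf /=; last lia.
  have -> : (j - bsize u == (bsize l).+1) by lia.
  lia.
Qed.

(** Symmetrically, only decreasing relations appear between u and v. *)
Lemma tree_lhd_under u v i j : i < j ->
  tree_lhd (under u v) i j = tree_lhd u i j ||
    [&& bsize u < i, bsize u < j & tree_lhd v (i - bsize u) (j - bsize u)].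
Proof.
elim: u i j => [|l _ r IHr] i j hij /=.
  rewrite !subn0; case h : (tree_lhd v i j); last by rewrite !andbF.
  have := tree_lhd_bound h; lia.
rewrite bsize_under; case: (ltngtP j (bsize l).+1) => h.
- case: (tree_lhd l i j) => //=; lia.
- case: (leqP i (bsize l).+1) => h1 /=; first lia.
  rewrite IHr; last lia.
  have -> : i - (bsize l).+1 - bsize r = i - (bsize l + bsize r).+1 by lia.
  have -> : j - (bsize l).+1 - bsize r = j - (bsize l + bsize r).+1 by lia.
  case: (tree_lhd r _ _) => //=.
  case: (tree_lhd v _ _); rewrite ?andbF // ?andbT; lia.
- lia.
Qed.

(** * The interval of a noncrossing tree *)

(** The recursion (A > x < B) * R, for the two ends of the interval and for the
    list of its trees. *)
Fixpoint nmin t : btree :=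
  if t is Arch A B R then over (BNode (nmin A) (nmin B)) (nmin R) else BLeaf.

Fixpoint nmax t : btree :=
  if t is Arch A B R then under (BNode (nmax A) (nmax B)) (nmax R) else BLeaf.

Fixpoint ntrees t : seq btree :=
  if t is Arch A B R then
    flatten [seq tprod u v |
      u <- [seq BNode l r | l <- ntrees A, r <- ntrees B], v <- ntrees R]
  else [:: BLeaf].

Lemma nmin_arch A B R :
  nmin (Arch A B R) = over (BNode (nmin A) (nmin B)) (nmin R).
Proof. by []. Qed.

Lemma nmax_arch A B R :
  nmax (Arch A B R) = under (BNode (nmax A) (nmax B)) (nmax R).
Proof. by []. Qed.

Lemma bsize_nmin t : bsize (nmin t) = nsize t.
Proof. elim: t => // A IA B IB R IR; rewrite nmin_arch bsize_over /=; lia. Qed.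

Lemma bsize_nmax t : bsize (nmax t) = nsize t.
Proof. elim: t => // A IA B IB R IR; rewrite nmax_arch bsize_under /=; lia. Qed.

Lemma nmin_le_nmax t : tam_le (nmin t) (nmax t).
Proof.
elim: t => [|A IA B IB R IR]; first exact: rt_refl.
rewrite nmin_arch nmax_arch; set x := BNode (nmin A) (nmin B).
apply: (@rt_trans _ _ _ (under x (nmin R)));
  last exact: under_mono (tam_node IA IB) IR.
have := over_cut_le (bsize x) (under x (nmin R)).
by rewrite lcut_under rcut_under.
Qed.

Lemma mem_ntrees T t : t \in ntrees T <-> tam_between (nmin T) (nmax T) t.
Proof.
elim: T t => [|A IA B IB R IR] t.
  rewrite inE; split => [/eqP->|[_ /tam_size /bsize0 ->//]].
  by split; exact: rt_refl.
rewrite nmin_arch nmax_arch between_prod;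
  last by rewrite /= !bsize_nmin !bsize_nmax.
set x := BNode (nmin A) (nmin B).
rewrite between_node ?bsize_nmin ?bsize_nmax //.
split.
  case/flattenP=> s /allpairsP[[u v] /=].
  move=> [/allpairsP[[l r] /= [/IA hl /IB hr ->]] /IR hv ->].
  move=> ht; have [] := tprod_cut ht.
  have -> : bsize (BNode l r) = bsize x.
    by rewrite /= (tam_size hl.1) (tam_size hr.1).
  by move=> -> ->; split=> //; exists l, r.
case=> [[l [r [h1 /IA h2 /IB h3]]] /IR h4].
apply/flattenP; exists (tprod (lcut (bsize x) t) (rcut (bsize x) t));
  last exact: cut_tprod.
by apply: allpairs_f => //; rewrite h1; apply: allpairs_f.
Qed.

Lemma ntrees_size T t : t \in ntrees T -> bsize t = nsize T.
Proof. by case/mem_ntrees=> /tam_size <-; rewrite bsize_nmin. Qed.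

Lemma uniq_flatmap (I J : eqType) (s : seq I) (F : I -> seq J)
    (key : J -> I) :
  uniq s -> (forall i, i \in s -> uniq (F i)) ->
  (forall i j, i \in s -> j \in F i -> key j = i) -> uniq (flatten (map F s)).
Proof.
elim: s => [//|i s IH] /= /andP[ni us] hF hk.
rewrite cat_uniq hF ?mem_head //= IH //; last first.
- by move=> i' j hi; apply: hk; rewrite inE hi orbT.
- by move=> i' hi; apply: hF; rewrite inE hi orbT.
rewrite andbT; apply/hasPn => j /flatten_mapP[i' hi' hj].
apply/negP => hj'; move: ni; rewrite -(hk i j) ?mem_head //.
by rewrite (hk i' j) ?hi' // inE hi' orbT.
Qed.

(** The factors of a tree of the product are found by cutting it after the
    vertices of A, the root and the vertices of B. *)
Lemma ntrees_uniq T : uniq (ntrees T).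
Proof.
elim: T => [//|A IA B IB R IR] /=.
set s := [seq BNode l r | l <- ntrees A, r <- ntrees B].
have us : uniq s by apply: allpairs_uniq => // -[x y] [x' y'] _ _ /= [-> ->].
have hs u : u \in s -> bsize u = (nsize A + nsize B).+1.
  by case/allpairsP => -[l r] /= [/ntrees_size hl /ntrees_size hr ->] /=; lia.
have -> : [seq tprod u v | u <- s, v <- ntrees R] =
   [seq tprod p.1 p.2 | p <- [seq (u, v) | u <- s, v <- ntrees R]].
  by rewrite map_allpairs.
pose p := (nsize A + nsize B).+1.
apply: (@uniq_flatmap _ _ _ _ (fun t => (lcut p t, rcut p t))).
- by apply: allpairs_uniq => // -[x y] [x' y'].
- by move=> q _; apply: tprod_uniq.
- move=> q t /allpairsP[[u v] /= [/hs hu _ ->]] /= /tprod_cut.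
  by rewrite hu -/p => -[-> ->].
Qed.

Lemma nlhd_shift t d c i j : nlhd t (d + c) (i + c) (j + c) = nlhd t d i j.
Proof.
elim: t d => //= A IA B IB R IR d.
have e1 : (d + c + nsize A).+1 = (d + nsize A).+1 + c by lia.
have e2 : d + c + nsize A + (nsize B).+1 = d + nsize A + (nsize B).+1 + c by lia.
rewrite e1 e2 IA IB IR eqn_add2r ltn_add2r leq_add2r //.
Qed.

Lemma nlhd0 t d i j :
  nlhd t d i j = [&& d < i, d < j & nlhd t 0 (i - d) (j - d)].
Proof.
have [h1|h1] := ltnP d i; last first.
  by apply/negP => /nlhd_bound; lia.
have [h2|h2] := ltnP d j; last first.
  by apply/negP => /nlhd_bound; lia.
rewrite -(nlhd_shift t 0 d) /= add0n; congr nlhd; lia.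
Qed.

(** The clause of the arch and those of A and B, compared with a tree whose
    subtrees realize A and B; [tree_lhd_over] and [tree_lhd_under] deal with
    R. *)
Lemma tree_lhd_node A B l r i j (k := (nsize A).+1) :
  bsize l = nsize A -> bsize r = nsize B ->
  tree_lhd l i j = nlhd A 0 i j ->
  (k < i -> k < j -> tree_lhd r (i - k) (j - k) = nlhd B 0 (i - k) (j - k)) ->
  tree_lhd (BNode l r) i j =
  [|| (j == k) && (0 < i <= nsize A + (nsize B).+1), nlhd A 0 i j
    | nlhd B k i j].
Proof.
move=> sl sr hl hr; rewrite /= sl sr (nlhd0 B) -/k addnS.
have fA : nsize A < j -> nlhd A 0 i j = false.
  by move=> h; apply/negP => /nlhd_bound; lia.
case: (ltngtP j k) => h /=.
- by rewrite hl andbF orbF.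
- rewrite fA //=; last lia.
  by have [h1|//] := ltnP k i; rewrite hr.
- by rewrite fA; [rewrite andbF !orbF | lia].
Qed.

Lemma tree_lhd_nmin t i j : j < i -> tree_lhd (nmin t) i j = nlhd t 0 i j.
Proof.
elim: t i j => [//|A IA B IB R IR] i j hij.
rewrite nmin_arch tree_lhd_over // (@tree_lhd_node A B) ?bsize_nmin //.
- rewrite [nlhd (Arch _ _ _) _ _ _]/= !add0n (nlhd0 R) -!orbA /= !bsize_nmin.
  rewrite addnS; congr [|| _, _, _ | _].
  by case: ltnP => // h1; case: ltnP => // h2; rewrite IR //; lia.
- exact: IA.
- by move=> h1 h2; apply: IB; lia.
Qed.

Lemma tree_lhd_nmax t i j : i < j -> tree_lhd (nmax t) i j = nlhd t 0 i j.
Proof.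
elim: t i j => [//|A IA B IB R IR] i j hij.
rewrite nmax_arch tree_lhd_under // (@tree_lhd_node A B) ?bsize_nmax //.
- rewrite [nlhd (Arch _ _ _) _ _ _]/= !add0n (nlhd0 R) -!orbA /= !bsize_nmax.
  rewrite addnS; congr [|| _, _, _ | _].
  by case: ltnP => // h1; case: ltnP => // h2; rewrite IR //; lia.
- exact: IA.
- by move=> h1 h2; apply: IB; lia.
Qed.

Lemma nlhd_interval t i j :
  nlhd t 0 i j <-> interval_lhd (nsize t) (nmin t) (nmax t) i j.
Proof.
have [ip_d ip_r _ _ _ _] := nlhd_interval_poset t.
split.
  move=> h; have [h1 h2] := ip_d _ _ h.
  case: (ltngtP i j) => hij.
  - by apply: Or33; rewrite tree_lhd_nmax.
  - by apply: Or32; rewrite tree_lhd_nmin.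
  - exact: Or31.
case=> [[<- h]|[h1]|[h1]]; first exact: ip_r.
  by rewrite tree_lhd_nmin.
by rewrite tree_lhd_nmax.
Qed.

(** * Linear extension and operadic composition *)

Section Linear.
Variables (K : comNzRingType) (V : lmodType K).
Local Open Scope ring_scope.

Definition lin (h : dterm -> V) (f : {malg K[dterm]}) : V :=
  \sum_(t <- msupp f) f@_t *: h t.

Lemma linEw h f (D : {fset dterm}) : (msupp f `<=` D)%fset ->
  lin h f = \sum_(t <- D) f@_t *: h t.
Proof.
move=> sD; apply: big_fset_incl => // t _ /mcoeff_outdom ->.
by rewrite scale0r.
Qed.

Lemma linD h f g : lin h (f + g) = lin h f + lin h g.
Proof.
rewrite (linEw _ (msuppD_le f g)) (linEw _ (fsubsetUl (msupp f) (msupp g))).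
rewrite (linEw _ (fsubsetUr (msupp f) (msupp g))) -big_split /=.
by apply: eq_bigr => t _; rewrite mcoeffD scalerDl.
Qed.

Lemma linZ h c f : lin h (c *: f) = c *: lin h f.
Proof.
rewrite (linEw _ (msuppZ_le c f)) /lin scaler_sumr.
by apply: eq_bigr => t _; rewrite mcoeffZ scalerA.
Qed.

Lemma lin0 h : lin h 0 = 0.
Proof. by rewrite /lin msupp0 big_nil. Qed.

Lemma linN h f : lin h (- f) = - lin h f.
Proof. by rewrite -[- f]scaleN1r linZ scaleN1r. Qed.

Lemma linB h f g : lin h (f - g) = lin h f - lin h g.
Proof. by rewrite linD linN. Qed.

Lemma linU h t : lin h << t >> = h t.
Proof. by rewrite /lin msuppU oner_eq0 big_seq_fset1 mcoeffUU scale1r. Qed.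

Lemma lin_sum (I : Type) (s : seq I) (F : I -> {malg K[dterm]}) h :
  lin h (\sum_(i <- s) F i) = \sum_(i <- s) lin h (F i).
Proof.
elim: s => [|i s IH]; first by rewrite !big_nil lin0.
by rewrite !big_cons linD IH.
Qed.

Lemma eq_lin h h' f : (forall t, t \in msupp f -> h t = h' t) ->
  lin h f = lin h' f.
Proof.
move=> e; rewrite /lin big_seq [RHS]big_seq.
by apply: eq_bigr => t /e ->.
Qed.

Lemma lin_addl h h' f : lin (fun t => h t + h' t) f = lin h f + lin h' f.
Proof. by rewrite /lin -big_split /=; apply: eq_bigr => t _; rewrite scalerDr. Qed.

Lemma lin_scalel c h f : lin (fun t => c *: h t) f = c *: lin h f.
Proof.
rewrite /lin scaler_sumr; apply: eq_bigr => t _.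
by rewrite !scalerA mulrC.
Qed.

Lemma lin_eq0 h f : (forall t, t \in msupp f -> h t = 0) -> lin h f = 0.
Proof.
by move=> e; rewrite /lin big_seq big1 // => t /e ->; rewrite scaler0.
Qed.

Lemma lin_exchange (F : dterm -> dterm -> V) f g :
  lin (fun q => lin (fun s => F q s) g) f =
  lin (fun s => lin (fun q => F q s) f) g.
Proof.
rewrite /lin; under eq_bigr => q _ do rewrite scaler_sumr.
rewrite exchange_big /=; apply: eq_bigr => s _; rewrite scaler_sumr.
by apply: eq_bigr => q _; rewrite !scalerA mulrC.
Qed.

Lemma lin_lin (h : dterm -> V) (h' : dterm -> {malg K[dterm]}) f :
  lin h (\sum_(t <- msupp f) f@_t *: h' t) = lin (fun t => lin h (h' t)) f.
Proof. by rewrite lin_sum; apply: eq_bigr => t _; rewrite linZ. Qed.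

End Linear.

Section DendTheory.
Variable K : comNzRingType.
Local Open Scope ring_scope.
Notation M := {malg K[dterm]}.
Implicit Types (f g : M).

Lemma malgUZ (c : K) (t : dterm) : << c *g t >> = c *: << t >> :> M.
Proof.
apply/malgP => k; rewrite mcoeffZ !mcoeffU.
by case: eqP; rewrite ?mulr1n ?mulr1 // !mulr0n mulr0.
Qed.

Lemma dcompE f i g :
  dcomp f i g = lin (fun t => lin (fun s => << dsubst t i s >>) g) f.
Proof.
rewrite /dcomp /lin; apply: eq_bigr => t _; rewrite scaler_sumr.
by apply: eq_bigr => s _; rewrite malgUZ scalerA.
Qed.

Lemma dcompDl f f' i g : dcomp (f + f') i g = dcomp f i g + dcomp f' i g.
Proof. by rewrite !dcompE linD. Qed.

Lemma dcompBl f f' i g : dcomp (f - f') i g = dcomp f i g - dcomp f' i g.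
Proof. by rewrite !dcompE linB. Qed.

Lemma dcompBr f i g g' : dcomp f i (g - g') = dcomp f i g - dcomp f i g'.
Proof.
pose h g t := lin (fun s => << dsubst t i s >> : M) g.
rewrite !dcompE -/(h g) -/(h g').
have <- : lin (fun t => (-1 : K) *: h g' t) f = - lin (h g') f.
  by rewrite lin_scalel scaleN1r.
by rewrite -lin_addl; apply: eq_lin => t _; rewrite linB scaleN1r.
Qed.

Lemma dcompUl t i g : dcomp << t >> i g = lin (fun s => << dsubst t i s >>) g.
Proof. by rewrite dcompE linU. Qed.

Lemma dcompUU t i s : dcomp << t >> i << s >> = << dsubst t i s >> :> M.
Proof. by rewrite dcompUl linU. Qed.

Lemma dcomp_suml (I : Type) (r : seq I) (F : I -> M) i g :
  dcomp (\sum_(j <- r) F j) i g = \sum_(j <- r) dcomp (F j) i g.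
Proof. by rewrite dcompE lin_sum; apply: eq_bigr => j _; rewrite dcompE. Qed.

Lemma dcomp_sumUr (I : Type) (r : seq I) t i (s : I -> dterm) :
  dcomp << t >> i (\sum_(j <- r) << s j >>) =
  \sum_(j <- r) << dsubst t i (s j) >> :> M.
Proof. by rewrite dcompUl lin_sum; apply: eq_bigr => j _; rewrite linU. Qed.

Lemma arity_gt0 t : (0 < arity t)%N.
Proof. elim: t => //=; lia. Qed.

Lemma arity_dsubst t i s : (0 < i <= arity t)%N ->
  arity (dsubst t i s) = (arity t + arity s).-1.
Proof.
elim: t i => [|l IHl r IHr|l IHl r IHr] i /= hi; first lia.
  have := arity_gt0 l; have := arity_gt0 r.
  by case: ifP => h /=; rewrite ?IHl ?IHr; lia.
have := arity_gt0 l; have := arity_gt0 r.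
by case: ifP => h /=; rewrite ?IHl ?IHr; lia.
Qed.

Lemma of_arity0 n : of_arity n (0 : M).
Proof. by move=> t; rewrite msupp0 inE. Qed.

Lemma of_arityD n f g : of_arity n f -> of_arity n g -> of_arity n (f + g).
Proof.
move=> hf hg t /(fsubsetP (msuppD_le f g)); rewrite inE => /orP[/hf|/hg] //.
Qed.

Lemma of_arityZ n c f : of_arity n f -> of_arity n (c *: f).
Proof. by move=> hf t /(fsubsetP (msuppZ_le c f)) /hf. Qed.

Lemma of_arityB n f g : of_arity n f -> of_arity n g -> of_arity n (f - g).
Proof.
by move=> hf hg; rewrite -scaleN1r; apply: of_arityD => //; apply: of_arityZ.
Qed.

Lemma of_arityU n t : arity t = n -> of_arity n (<< t >> : M).
Proof. by move=> ht s; rewrite msuppU oner_eq0 inE => /eqP ->. Qed.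

Lemma of_arity_sum (I : eqType) n (r : seq I) (F : I -> M) :
  (forall i, i \in r -> of_arity n (F i)) -> of_arity n (\sum_(i <- r) F i).
Proof.
rewrite big_seq => h; elim/big_ind: _ => // [|x y]; first exact: of_arity0.
exact: of_arityD.
Qed.

Lemma of_arity_dcomp m n i f g : (0 < i <= m)%N ->
  of_arity m f -> of_arity n g -> of_arity (m + n).-1 (dcomp f i g).
Proof.
move=> hi hf hg; rewrite dcompE /lin; apply: of_arity_sum => t /hf ht.
apply: of_arityZ; apply: of_arity_sum => s /hg hs.
by apply/of_arityZ/of_arityU; rewrite arity_dsubst ht ?hs.
Qed.

Lemma ideal_arity n f : dend_ideal n f -> of_arity n f.
Proof.
elim=> {n f}.
- by apply: of_arityB; [exact: of_arityU|apply: of_arityD; exact: of_arityU].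
- by apply: of_arityB; exact: of_arityU.
- by apply: of_arityB; [apply: of_arityD|]; exact: of_arityU.
- exact: of_arity0.
- by move=> n f g _ hf _ hg; apply: of_arityD.
- by move=> n c f _ hf; apply: of_arityZ.
- by move=> m n i f g hi _ hf hg; apply: of_arity_dcomp.
- by move=> m n i f g hi hf _ hg; apply: of_arity_dcomp.
Qed.

(** * A model of the dendriform relations *)

(** Both operations at once: [true] stands for [DPrec]. *)
Definition dop (b : bool) : dterm -> dterm -> dterm := if b then DPrec else DSucc.

Lemma dop_ind (P : dterm -> Prop) : P DVar ->
  (forall b l r, P l -> P r -> P (dop b l r)) -> forall q, P q.
Proof.
move=> h0 h; elim=> [//|l hl r hr|l hl r hr]; first exact: (h true).
exact: (h false).
Qed.

Lemma arity_dop b l r : arity (dop b l r) = (arity l + arity r)%N.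
Proof. by case: b. Qed.

Lemma dsubst_dop b l r i s : dsubst (dop b l r) i s =
  if (i <= arity l)%N then dop b (dsubst l i s) r
  else dop b l (dsubst r (i - arity l) s).
Proof. by case: b => /=; case: ifP. Qed.

(** A homogeneous function on binary trees: a degree, and a function that is
    meant to be evaluated on trees of that degree. *)
Definition hfun := (nat * (btree -> K))%type.

(** The dual of the product [tprod]: the tree is cut at the degree of the first
    factor, and the operation says on which side the root has to fall.  As the
    degrees are fixed, no sum over cuts is needed. *)
Definition hop (b : bool) (x y : hfun) : hfun :=
  ((x.1 + y.1)%N, fun t =>
     if (lsize t < x.1)%N == b then x.2 (lcut x.1 t) * y.2 (rcut x.1 t) else 0).

(** The value of a monomial; [v j] is the value of its input number j + 1. *)
Fixpoint hev (q : dterm) (v : nat -> hfun) : hfun :=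
  match q with
  | DVar => v 0%N
  | DPrec l r => hop true (hev l v) (hev r (fun j => v (arity l + j)%N))
  | DSucc l r => hop false (hev l v) (hev r (fun j => v (arity l + j)%N))
  end.

Lemma hev_dop b l r v :
  hev (dop b l r) v = hop b (hev l v) (hev r (fun j => v (arity l + j)%N)).
Proof. by case: b. Qed.

Definition heq (a b : hfun) := a.1 = b.1 /\ a.2 =1 b.2.

Lemma heq_hop b x x' y y' : heq x x' -> heq y y' -> heq (hop b x y) (hop b x' y').
Proof.
by case=> h1 h2 [h3 h4]; split=> [|t] /=; rewrite -?h1 -?h3 // h2 h4.
Qed.

Lemma hev_ext q v w : (forall j, (j < arity q)%N -> heq (v j) (w j)) ->
  heq (hev q v) (hev q w).
Proof.
elim/dop_ind: q v w => [|b l r IHl IHr] v w; first by move=> h; apply: h.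
rewrite arity_dop !hev_dop => h; apply: heq_hop.
  by apply: IHl => j hj; apply: h; lia.
by apply: IHr => j hj; apply: h; lia.
Qed.

Lemma heq_trans x y z : heq x y -> heq y z -> heq x z.
Proof. by case=> h1 h2 [h3 h4]; split=> [|t]; rewrite ?h1 ?h2. Qed.

(** The inputs of a composite, as seen by the outer monomial: the n inputs from
    p on are replaced by the single value a. *)
Definition hsub (v : nat -> hfun) (p n : nat) (a : hfun) (j : nat) : hfun :=
  if (j < p)%N then v j else if j == p then a else v (j + n).-1.

Lemma hev_dsubst q i s v : (0 < i <= arity q)%N ->
  heq (hev (dsubst q i s) v)
      (hev q (hsub v i.-1 (arity s) (hev s (fun j => v (i.-1 + j)%N)))).
Proof.
have hs := arity_gt0 s.
elim/dop_ind: q i v => [|b l r IHl IHr] i v.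
  by move=> /= hi; have -> : i = 1%N by lia.
rewrite arity_dop dsubst_dop => hi.
case: ifP => h; rewrite !hev_dop; apply: heq_hop.
- by apply: IHl; lia.
- apply: hev_ext => j _; rewrite /hsub arity_dsubst; last lia.
  case: ifP => h1; first lia; case: eqP => h2; first lia.
  by have -> : ((arity l + arity s).-1 + j = (arity l + j + arity s).-1)%N by lia.
- by apply: hev_ext => j hj; rewrite /hsub; have -> : (j < i.-1)%N by lia.
- have hi' : (0 < i - arity l <= arity r)%N by lia.
  apply: heq_trans (IHr _ _ hi') _; apply: hev_ext => j _; rewrite /hsub.
  have -> : (j < (i - arity l).-1)%N = (arity l + j < i.-1)%N by lia.
  have -> : (j == (i - arity l).-1)%N = (arity l + j == i.-1)%N by lia.
  case: ifP => // h5; case: ifP => // h6.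
    apply: hev_ext => j' _.
    by have -> : (arity l + ((i - arity l).-1 + j') = i.-1 + j')%N by lia.
  by have -> : (arity l + (j + arity s).-1 = (arity l + j + arity s).-1)%N by lia.
Qed.

Lemma hev_deg q v : (hev q v).1 = (\sum_(0 <= j < arity q) (v j).1)%N.
Proof.
elim/dop_ind: q v => [|b l r IHl IHr] v; first by rewrite /= big_nat1.
rewrite hev_dop arity_dop /= IHl IHr.
rewrite [RHS](@big_cat_nat _ _ _ (arity l)) ?leq_addr //=.
congr addn; rewrite -[X in _ = bigop _ (index_iota X _) _]add0n big_addn addKn.
by apply: eq_bigr => j _; rewrite addnC.
Qed.

(** A monomial uses each input once, so its value is linear in that input as
    long as the degree does not vary. *)
Lemma hev_linear q (I : Type) (r : seq I) (c : I -> K) (x : I -> hfun) m p w :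
  (forall i, (x i).1 = m) ->
  (p < arity q)%N ->
  (forall t, \sum_(i <- r) c i * (x i).2 t = 0) ->
  forall t, \sum_(i <- r) c i *
    (hev q (fun j => if j == p then x i else w j)).2 t = 0.
Proof.
move=> hm; elim/dop_ind: q p w => [|b l r' IHl IHr] p w.
  by case: p.
rewrite arity_dop => hp hx t.
have deg1 i : (hev l (fun j => if j == p then x i else w j)).1 =
  (\sum_(0 <= j < arity l) if j == p then m else (w j).1)%N.
  by rewrite hev_deg; apply: eq_bigr => j _; case: ifP; rewrite ?hm.
set D := (\sum_(0 <= j < arity l) if j == p then m else (w j).1)%N.
have [h|h] := ltnP p (arity l).
  have E i : heq
     (hev r' (fun j => if (arity l + j)%N == p then x i else w (arity l + j)%N))
     (hev r' (fun j => w (arity l + j)%N)).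
    by apply: hev_ext => j _; case: eqP => //; lia.
  under eq_bigr => i _ do rewrite hev_dop /= deg1 -/D (E i).2.
  case: ((lsize t < D)%N == b); last by rewrite big1 // => i _; rewrite mulr0.
  under eq_bigr => i _ do rewrite mulrA.
  by rewrite -mulr_suml IHl // mul0r.
have E i : heq (hev l (fun j => if j == p then x i else w j)) (hev l w).
  by apply: hev_ext => j hj; case: eqP => //; lia.
have E' i : heq
   (hev r' (fun j => if (arity l + j)%N == p then x i else w (arity l + j)%N))
   (hev r' (fun j => if j == (p - arity l)%N then x i else w (arity l + j)%N)).
  apply: hev_ext => j _.
  by have -> : (arity l + j == p)%N = (j == p - arity l)%N by lia.
under eq_bigr => i _ do rewrite hev_dop /= deg1 -/D (E i).2 (E' i).2.
case: ((lsize t < D)%N == b); last by rewrite big1 // => i _; rewrite mulr0.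
under eq_bigr => i _ do rewrite mulrCA.
rewrite -mulr_sumr IHr ?mulr0 //; lia.
Qed.

Lemma hop_assocl b b' x y z t : (hop b (hop b' x y) z).2 t =
  if ((lsize t < x.1 + y.1)%N == b) &&
     ((lsize (lcut (x.1 + y.1) t) < x.1)%N == b')
  then x.2 (lcut x.1 t) * y.2 (lcut y.1 (rcut x.1 t)) * z.2 (rcut (x.1 + y.1) t)
  else 0.
Proof.
rewrite /= lcut_lcut ?leq_addr // rcut_lcut ?leq_addr // addKn.
by case: (_ == b); case: (_ == b'); rewrite ?mul0r.
Qed.

Lemma hop_assocr b b' x y z t : (hop b x (hop b' y z)).2 t =
  if ((lsize t < x.1)%N == b) && ((lsize (rcut x.1 t) < y.1)%N == b')
  then x.2 (lcut x.1 t) * y.2 (lcut y.1 (rcut x.1 t)) * z.2 (rcut (x.1 + y.1) t)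
  else 0.
Proof.
rewrite -(@rcut_rcut x.1 (x.1 + y.1)) ?leq_addr // addKn /=.
by case: (_ == b); case: (_ == b'); rewrite ?mulr0 ?mulrA.
Qed.

(** In each relation, both sides cut the tree into the same three pieces, so
    that only the positions of the root with respect to the two cuts have to be
    compared; a sum of two terms leaves one of these positions free. *)
Lemma hop_rel1 x y z t : (hop true (hop true x y) z).2 t =
  (hop true x (hop true y z)).2 t + (hop true x (hop false y z)).2 t.
Proof.
rewrite hop_assocl !hop_assocr !eqb_id !eqbF_neg.
have [h1|h1] := ltnP (lsize t) (x.1 + y.1); last first.
  have -> : (lsize t < x.1)%N = false by lia.
  by rewrite addr0.
rewrite lsize_lcut //; case: (lsize t < x.1)%N; rewrite ?addr0 //=.
by case: (_ < _)%N; rewrite ?addr0 ?add0r.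
Qed.

Lemma hop_rel2 x y z t : (hop true (hop false x y) z).2 t =
  (hop false x (hop true y z)).2 t.
Proof.
rewrite hop_assocl hop_assocr !eqb_id !eqbF_neg -!leqNgt.
have [h1|h1] := leqP x.1 (lsize t); last first.
  case: (ltnP (lsize t) (x.1 + y.1)) => h2 //; rewrite lsize_lcut //.
  by have -> : (x.1 <= lsize t)%N = false by lia.
rewrite lsize_rcut //.
have -> : (lsize t - x.1 < y.1)%N = (lsize t < x.1 + y.1)%N by lia.
by case: ltnP => // h2; rewrite lsize_lcut // h1.
Qed.

Lemma hop_rel3 x y z t :
  (hop false (hop true x y) z).2 t + (hop false (hop false x y) z).2 t =
  (hop false x (hop false y z)).2 t.
Proof.
rewrite !hop_assocl hop_assocr !eqb_id !eqbF_neg -!leqNgt.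
have [h1|h1] := leqP x.1 (lsize t); last first.
  have -> : (x.1 + y.1 <= lsize t)%N = false by lia.
  by rewrite addr0.
rewrite lsize_rcut //.
have -> : (y.1 <= lsize t - x.1)%N = (x.1 + y.1 <= lsize t)%N by lia.
case: (x.1 + y.1 <= lsize t)%N; rewrite ?addr0 //=.
by case: ltnP; rewrite ?addr0 ?add0r.
Qed.

(** The relations hold by the previous lemmas.  Composition preserves the
    property: on one side because the elements of the ideal vanish for all
    values of the inputs, on the other by linearity in one input. *)
Lemma hev_ideal n f : dend_ideal n f ->
  forall v t, lin (fun q => (hev q v).2 t : K^o) f = 0.
Proof.
elim=> {n f}.
- move=> v t; rewrite linB linD !linU.
  by apply/eqP; rewrite subr_eq0; apply/eqP/hop_rel1.
- move=> v t; rewrite linB !linU.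
  by apply/eqP; rewrite subr_eq0; apply/eqP/hop_rel2.
- move=> v t; rewrite linB linD !linU.
  by apply/eqP; rewrite subr_eq0; apply/eqP/hop_rel3.
- by move=> n v t; rewrite lin0.
- by move=> n f g _ hf _ hg v t; rewrite linD hf hg addr0.
- by move=> n c f _ hf v t; rewrite linZ hf scaler0.
- move=> m n i f g hi /ideal_arity af hf ag v t.
  rewrite dcompE [X in lin _ X]/lin lin_lin.
  have E q s : (0 < i <= arity q)%N -> _ := fun h => (@hev_dsubst q i s v h).2 t.
  transitivity (lin (fun q => lin (fun s => (hev (dsubst q i s) v).2 t : K^o) g) f).
    apply: eq_lin => q _; rewrite [X in lin _ X]/lin lin_lin.
    by apply: eq_lin => s _; rewrite linU.
  rewrite lin_exchange; apply: lin_eq0 => s _.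
  pose w := hsub v i.-1 (arity s) (hev s (fun j => v (i.-1 + j)%N)).
  transitivity (lin (fun q => (hev q w).2 t : K^o) f); last exact: hf.
  by apply: eq_lin => q /af hq; rewrite E // hq.
- move=> m n i f g hi af /ideal_arity ag hg v t.
  rewrite dcompE [X in lin _ X]/lin lin_lin; apply: lin_eq0 => q /af hq.
  rewrite [X in lin _ X]/lin lin_lin.
  pose v' j := v (i.-1 + j)%N.
  pose d := (\sum_(0 <= j < n) (v' j).1)%N.
  pose x s : hfun := (d, (hev s v').2).
  pose w j := if (j < i.-1)%N then v j else v (j + n).-1.
  transitivity (lin (fun s =>
      (hev q (fun j => if j == i.-1 then x s else w j)).2 t : K^o) g).
    apply: eq_lin => s /ag hs; rewrite linU (hev_dsubst _ _ _).2 ?hq //.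
    apply: (hev_ext _).2 => j _; rewrite /hsub /w hs.
    case: ltngtP => //= _; split=> //=.
    by rewrite /x /= hev_deg hs.
  by apply: (@hev_linear q _ _ _ x d i.-1 w) => [//||t']; [lia|exact: hg].
Qed.

End DendTheory.

(** * Linear independence of binary trees *)

Section Dendriform.
Variable K : comNzRingType.
Local Open Scope ring_scope.
Notation M := {malg K[dterm]}.
Notation d := dend_of_tree.
Implicit Types (f g : M).

(** The root of a tree with its left subtree, without its right subtree. *)
Definition spine l : dterm := if l is BLeaf then DVar else DSucc (d l) DVar.

Lemma dend_node l r :
  d (BNode l r) = if r is BLeaf then spine l else DPrec (spine l) (d r).
Proof. by []. Qed.

Lemma arity_dend t : t <> BLeaf -> arity (d t) = bsize t.
Proof.
have arS l : (l <> BLeaf -> arity (d l) = bsize l) ->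
    arity (spine l) = (bsize l).+1.
  case: l => [//|l r] h /=; rewrite -/(d (BNode l r)) h //=; lia.
elim: t => [//|l IHl r IHr] _; rewrite dend_node.
case: r IHr => [_|r r' IHr]; first by rewrite arS //= addn0.
rewrite [arity _]/= -/(d (BNode r r')) arS // IHr //=; lia.
Qed.

Lemma arity_spine l : arity (spine l) = (bsize l).+1.
Proof.
case: l => [//|l r]; rewrite [arity _]/= -/(d (BNode l r)) arity_dend //=; lia.
Qed.

Definition hvar : hfun K := (1%N, fun t => (t == BNode BLeaf BLeaf)%:R).
Definition coef (t : btree) (q : dterm) : K := (hev q (fun=> hvar)).2 t.

Lemma coef_dop b p q t : coef t (dop b p q) =
  if (lsize t < arity p)%N == b
  then coef (lcut (arity p) t) p * coef (rcut (arity p) t) q else 0.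
Proof.
rewrite /coef hev_dop /=.
have -> : (hev p (fun=> hvar)).1 = arity p; last by [].
by rewrite hev_deg /= sum_nat_const_nat subn0 muln1.
Qed.

Lemma coef_var t : coef t DVar = (t == BNode BLeaf BLeaf)%:R.
Proof. by []. Qed.

Lemma natr_mulb (a b : bool) : a%:R * b%:R = (a && b)%:R :> K.
Proof. by case: a; rewrite ?mul1r ?mul0r. Qed.

Lemma coef_spine l t : bsize t = (bsize l).+1 ->
  (l <> BLeaf -> forall t', bsize t' = bsize l -> coef t' (d l) = (t' == l)%:R) ->
  coef t (spine l) = (t == BNode l BLeaf)%:R.
Proof.
move=> ht hl; case: l ht hl => [_ _|l1 l2]; first exact: coef_var.
set l := BNode l1 l2 => ht hl.
have -> : spine l = dop false (d l) DVar by [].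
rewrite coef_dop arity_dend // eqbF_neg -leqNgt coef_var hl //; last first.
  by rewrite bsize_lcut ht; lia.
rewrite natr_mulb; case: t ht => [//|a b] ht.
rewrite [lsize _]/=; case: ifP => h.
  rewrite [lcut _ _]/= [rcut _ _]/= h.
  congr (nat_of_bool _)%:R; apply/andP/eqP => [[/eqP h1 /eqP [h2 h3]]|[-> ->]].
    move: ht h1 h2; rewrite h3 => /= ht h1 h2.
    by rewrite lcut_all in h1; [rewrite h1|move: ht; rewrite /=; lia].
  by rewrite lcut_all // rcut_all // !eqxx.
case: eqP => // -[ea eb]; move: h; rewrite ea; lia.
Qed.

(** Reading the operation (l > x) < r backwards cuts the tree t after and before
    the position of the root of s; the conditions on the root force the roots
    of s and t to agree. *)
Lemma coef_dend s t : s <> BLeaf -> bsize t = bsize s ->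
  coef t (d s) = (t == s)%:R.
Proof.
elim: s t => [//|l IHl r IHr] t _ ht; rewrite dend_node.
case: r IHr ht => [_|r1 r2 IHr] ht.
  by apply: coef_spine => [|hl t' ht']; [rewrite ht /=; lia|exact: IHl].
set r := BNode r1 r2 in IHr ht *.
have -> : DPrec (spine l) (d r) = dop true (spine l) (d r) by [].
rewrite coef_dop arity_spine eqb_id (coef_spine (l := l)); last 2 first.
- by rewrite bsize_lcut ht /=; lia.
- by move=> hl t' ht'; exact: IHl.
rewrite IHr //; last by rewrite bsize_rcut ht /=; lia.
rewrite natr_mulb; case: t ht => [//|a b] ht.
have [h|h] := ltnP; last first.
  by case: eqP => // -[ea eb]; move: h; rewrite ea /=; lia.
have [h'|h'] := leqP (bsize l).+1 (bsize a).
  by move: h => /=; lia.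
congr (nat_of_bool _)%:R; rewrite [lcut _ _]/= [rcut _ _]/= leqNgt h' /=.
rewrite subSS; apply/andP/eqP => [[/eqP [h1 h2] /eqP h3]|[-> ->]].
  by move: h2 h3; rewrite h1 subnn lcut0 rcut0 => _ ->.
by rewrite subnn lcut0 rcut0 !eqxx.
Qed.

Lemma dend_sum_inj n (I J : {fset btree}) : (0 < n)%N ->
  (forall t, t \in I -> bsize t = n) -> (forall t, t \in J -> bsize t = n) ->
  dend_eq n (\sum_(t <- I) << d t >> : M) (\sum_(t <- J) << d t >>) -> I = J.
Proof.
move=> hn hI hJ /hev_ideal h.
have nz s : bsize s = n -> s <> BLeaf.
  by move=> hs e; move: hs hn; rewrite e /= => <-.
have mem (S : {fset btree}) t : (forall s, s \in S -> bsize s = n) -> bsize t = n ->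
    lin (fun q => coef t q : K^o) (\sum_(s <- S) << d s >>) = (t \in S)%:R.
  move=> hS ht; rewrite lin_sum.
  under eq_bigr => s _ do rewrite linU.
  rewrite big_seq (eq_bigr (fun s => (t == s)%:R)); last first.
    by move=> s hs; rewrite coef_dend //; [apply: nz; rewrite hS|rewrite ht hS].
  rewrite -big_seq; have [tS|tS] := boolP (t \in S).
    rewrite (big_fsetD1 t tS) /= eqxx big_seq big1 ?addr0 // => s.
    by rewrite !inE eq_sym => /andP[/negPf ->].
  rewrite big_seq big1 // => s hs; case: eqP => // e.
  by rewrite e hs in tS.
apply/fsetP => t.
have [ht|ht] := eqVneq (bsize t) n; last first.
  by apply/idP/idP => [/hI|/hJ] /eqP; rewrite (negPf ht).
have := h (fun=> hvar) t; rewrite linB !mem //.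
by case: (t \in I); case: (t \in J) => //= /eqP;
  rewrite ?subr0 ?sub0r ?oppr_eq0 oner_eq0.
Qed.

(** * Products of binary trees in the dendriform operad *)

Lemma dend_refl n f : dend_eq n f f.
Proof. by rewrite /dend_eq subrr; apply: DendZero. Qed.

Lemma dend_sym n f g : dend_eq n f g -> dend_eq n g f.
Proof. by rewrite /dend_eq => /(DendScale (-1)); rewrite scaleN1r opprB. Qed.

Lemma dend_trans n f g h : dend_eq n f g -> dend_eq n g h -> dend_eq n f h.
Proof.
rewrite /dend_eq => h1 h2; have := DendAdd h1 h2.
by rewrite addrA subrK.
Qed.

Lemma dend_add n f f' g g' : dend_eq n f f' -> dend_eq n g g' ->
  dend_eq n (f + g) (f' + g').
Proof.
by rewrite /dend_eq => h1 h2; have := DendAdd h1 h2; rewrite opprD addrACA.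
Qed.

Lemma dend_sum (I : eqType) n (r : seq I) (F G : I -> M) :
  (forall i, i \in r -> dend_eq n (F i) (G i)) ->
  dend_eq n (\sum_(i <- r) F i) (\sum_(i <- r) G i).
Proof.
elim: r => [|i r IH] h; first by rewrite !big_nil; apply: dend_refl.
rewrite !big_cons; apply: dend_add; first by apply: h; rewrite mem_head.
by apply: IH => j hj; apply: h; rewrite inE hj orbT.
Qed.

Lemma dend_comp m n i f f' g g' : (0 < i <= m)%N ->
  of_arity n g -> of_arity m f' ->
  dend_eq m f f' -> dend_eq n g g' ->
  dend_eq (m + n).-1 (dcomp f i g) (dcomp f' i g').
Proof.
move=> hi ag af hf hg; apply: (@dend_trans _ _ (dcomp f' i g)).
  by rewrite /dend_eq -dcompBl; apply: DendCompL.
by rewrite /dend_eq -dcompBr; apply: DendCompR.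
Qed.

Lemma dend_opl b a n f g : dend_eq n f g ->
  dend_eq (n + arity a)
    (lin (fun s => << dop b s a >>) f) (lin (fun s => << dop b s a >>) g).
Proof.
rewrite /dend_eq => h; rewrite -linB.
have aa : of_arity (arity a).+1 (<< dop b DVar a >> : M).
  by apply: of_arityU; rewrite arity_dop.
have := DendCompR (i := 1) (isT : (0 < 1 <= (arity a).+1)%N) aa h.
rewrite dcompUl addSn /= addnC; congr (dend_ideal _ _).
by apply: eq_lin => s _; rewrite dsubst_dop.
Qed.

Lemma dend_opr b a n f g : dend_eq n f g ->
  dend_eq (arity a + n)
    (lin (fun s => << dop b a s >>) f) (lin (fun s => << dop b a s >>) g).
Proof.
rewrite /dend_eq => h; rewrite -linB.
have aa : of_arity (arity a).+1 (<< dop b a DVar >> : M).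
  by apply: of_arityU; rewrite arity_dop addn1.
have hi : (0 < (arity a).+1 <= (arity a).+1)%N by rewrite leqnn.
have := DendCompR hi aa h.
rewrite dcompUl addSn /=; congr (dend_ideal _ _).
by apply: eq_lin => s _; rewrite dsubst_dop ltnn.
Qed.

Lemma ideal_subst3 f a b c : dend_ideal 3 f ->
  dend_ideal (arity a + arity b + arity c)
    (dcomp (dcomp (dcomp f 3 << c >>) 2 << b >>) 1 << a >>).
Proof.
move=> h; have aU t : of_arity (arity t) (<< t >> : M) by exact: of_arityU.
have -> : (arity a + arity b + arity c =
    (((3 + arity c).-1 + arity b).-1 + arity a).-1)%N.
  by have := arity_gt0 a; lia.
by do 3![apply: DendCompL => //].
Qed.

Lemma dend_rel1 a b c : dend_eq (arity a + arity b + arity c)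
  (<< DPrec (DPrec a b) c >> : M)
  (<< DPrec a (DPrec b c) >> + << DPrec a (DSucc b c) >>).
Proof.
have := ideal_subst3 a b c (DendRel1 K).
by rewrite !(dcompBl, dcompDl) !dcompUU /=.
Qed.

Lemma dend_rel2 a b c : dend_eq (arity a + arity b + arity c)
  (<< DPrec (DSucc a b) c >> : M) << DSucc a (DPrec b c) >>.
Proof.
have := ideal_subst3 a b c (DendRel2 K).
by rewrite !(dcompBl, dcompDl) !dcompUU /=.
Qed.

Lemma dend_rel3 a b c : dend_eq (arity a + arity b + arity c)
  (<< DSucc (DPrec a b) c >> + << DSucc (DSucc a b) c >> : M)
  << DSucc a (DSucc b c) >>.
Proof.
have := ideal_subst3 a b c (DendRel3 K).
by rewrite !(dcompBl, dcompDl) !dcompUU /=.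
Qed.

Lemma nonleaf_size t : (0 < bsize t)%N -> t <> BLeaf.
Proof. by case: t. Qed.

Lemma spineE t : t <> BLeaf -> spine t = DSucc (d t) DVar.
Proof. by case: t. Qed.

Lemma dend_nodeE l r : r <> BLeaf -> d (BNode l r) = DPrec (spine l) (d r).
Proof. by case: r. Qed.

(** By the first relation, ((l > x) < r) < v = (l > x) < (r * v), and by the two
    others u > ((l' > x) < r') = ((u * l') > x) < r'; these are the two halves
    of the list [tprod], to which the induction applies. *)
Lemma dend_prod u v : u <> BLeaf -> v <> BLeaf ->
  dend_eq (bsize u + bsize v)
    (<< DPrec (d u) (d v) >> + << DSucc (d u) (d v) >> : M)
    (\sum_(t <- tprod u v) << d t >>).
Proof.
have [N] := ubnP (bsize u + bsize v); elim: N u v => // N IH u v hN hu hv.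
case: u hu hN => [//|l r] hu hN; case: v hv hN => [//|l' r'] hv hN.
rewrite tprodE big_cat !big_map; set u := BNode l r; set v := BNode l' r'.
have au : arity (d u) = bsize u by exact: arity_dend.
have av : arity (d v) = bsize v by exact: arity_dend.
have su : bsize u = (bsize l + bsize r).+1 by [].
have sv : bsize v = (bsize l' + bsize r').+1 by [].
have prod_leaf x y t : x <> BLeaf -> t \in tprod x y -> t <> BLeaf.
  by case: x => // ? ? _ /tprod_size /= ht; apply: nonleaf_size; rewrite ht.
apply: dend_add.
- have [r0|r0] : r = BLeaf \/ r <> BLeaf by case: (r); [left|right].
    subst r; rewrite tprod0v big_seq1 (dend_nodeE l (r := v)) //.
    exact: dend_refl.
  have -> : d u = DPrec (spine l) (d r) by exact: dend_nodeE.
  have := dend_rel1 (spine l) (d r) (d v).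
  have -> : (arity (spine l) + arity (d r) + arity (d v) = bsize u + bsize v)%N.
    by rewrite arity_spine av arity_dend.
  move/dend_trans; apply.
  have hN' : (bsize r + bsize v < N)%N by move: hN => /=; lia.
  have := dend_opr true (spine l) (IH r v hN' r0 hv).
  have -> : (arity (spine l) + (bsize r + bsize v) = bsize u + bsize v)%N.
    by rewrite arity_spine su; lia.
  rewrite linD !linU lin_sum => /dend_trans; apply.
  rewrite (@eq_big_seq _ _ _ _ (tprod r v) _ (fun t => << d (BNode l t) >>)).
    exact: dend_refl.
  by move=> t /(prod_leaf _ _ _ r0) t0; rewrite linU dend_nodeE.
have core : dend_eq (bsize u + (bsize l').+1) << DSucc (d u) (spine l') >>
    (\sum_(t <- tprod u l') << spine t >> : M).
  have [l0|l0] : l' = BLeaf \/ l' <> BLeaf by case: (l'); [left|right].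
    by rewrite l0 tprodu0 big_seq1; apply: dend_refl.
  rewrite (spineE l0); have := dend_sym (dend_rel3 (d u) (d l') DVar).
  have -> : (arity (d u) + arity (d l') + arity DVar = bsize u + (bsize l').+1)%N.
    by rewrite au arity_dend // addn1 addnS.
  move/dend_trans; apply.
  have hN' : (bsize u + bsize l' < N)%N by move: hN; rewrite -/u -/v; lia.
  have := dend_opl false DVar (IH u l' hN' hu l0).
  rewrite linD !linU lin_sum addn1 -[X in dend_eq X]addnS => /dend_trans; apply.
  rewrite (@eq_big_seq _ _ _ _ (tprod u l') _ (fun t => << spine t >>)).
    exact: dend_refl.
  by move=> t /(prod_leaf _ _ _ hu) t0; rewrite linU spineE.
have [r0|r0] : r' = BLeaf \/ r' <> BLeaf by case: (r'); [left|right].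
  have -> : d v = spine l' by rewrite /v r0.
  by rewrite sv r0 addn0; exact: core.
have -> : d v = DPrec (spine l') (d r') by exact: dend_nodeE.
have := dend_sym (dend_rel2 (d u) (spine l') (d r')).
have -> : (arity (d u) + arity (spine l') + arity (d r') = bsize u + bsize v)%N.
  by rewrite arity_spine au arity_dend // sv; lia.
move/dend_trans; apply.
have := dend_opl true (d r') core.
have -> : (bsize u + (bsize l').+1 + arity (d r') = bsize u + bsize v)%N.
  by rewrite arity_dend // sv; lia.
rewrite linU lin_sum => /dend_trans; apply.
rewrite (@eq_big_seq _ _ _ _ (tprod u l') _ (fun t => << d (BNode t r') >>)).
  exact: dend_refl.
by move=> t _; rewrite linU dend_nodeE.
Qed.

End Dendriform.

(** * Glueing noncrossing trees *)

Definition shift c (e : edge) : edge := (e.1 + c, e.2 + c).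

Lemma nedges_shift t d c : nedges t (d + c) = map (shift c) (nedges t d).
Proof.
elim: t d => //= A IA B IB R IR d; rewrite !map_cat -IA -IB -IR /shift /=.
have e1 : (d + c + nsize A).+1 = (d + nsize A).+1 + c by lia.
have e2 : d + c + nsize A + (nsize B).+1 = d + nsize A + (nsize B).+1 + c by lia.
by rewrite e1 e2.
Qed.

(** The renumbering of the outer polygon in [nc_glue]. *)
Definition vgraft i k v := if v < i then v else (v + k).-1.
Definition egraft i k (e : edge) : edge := (vgraft i k e.1, vgraft i k e.2).

Lemma nedges_graft t d i k : i <= d -> 0 < k ->
  map (egraft i k) (nedges t d) = nedges t (d + k.-1).
Proof.
move=> hd hk; rewrite nedges_shift; apply/eq_in_map => e /nedges_bound he.
rewrite /egraft /vgraft /shift; congr pair; case: ifP; lia.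
Qed.

Lemma mem_glue F i k G (e : edge) : e \in nc_glue (nfset F) i k (nfset G) =
  (e \in map (egraft i k) (nedges F 0) ++ nedges G i.-1) &&
  (((i.-1, i) \in nedges F 0) && ((0, k) \in nedges G 0)
   || (e != (i.-1, i.-1 + k))).
Proof.
have E : (e \in [fset (vgraft i k e.1, vgraft i k e.2) | e in nfset F]
       `|` [fset (e.1 + i.-1, e.2 + i.-1)%N | e in nfset G])%fset =
   (e \in map (egraft i k) (nedges F 0) ++ nedges G i.-1).
  rewrite in_fsetU mem_cat -[X in nedges G X]add0n nedges_shift.
  congr orb.
    apply/imfsetP/mapP => -[e' /= h ->]; exists e' => //.
      by rewrite -in_nfset.
    by rewrite in_nfset.
  apply/imfsetP/mapP => -[e' /= h ->]; exists e' => //.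
    by rewrite -in_nfset.
  by rewrite in_nfset.
rewrite /nc_glue !in_nfset; case: ifP => _.
  by rewrite -/(vgraft i k) E andbT.
by rewrite in_fsetD1 E andbC.
Qed.

Definition Edge1 := Arch Pt Pt Pt.

Lemma nfset_glue T F i k G :
  (forall e : edge, (e \in nedges T 0) =
    (e \in map (egraft i k) (nedges F 0) ++ nedges G i.-1) &&
    (((i.-1, i) \in nedges F 0) && ((0, k) \in nedges G 0)
     || (e != (i.-1, i.-1 + k)))) ->
  nfset T = nc_glue (nfset F) i k (nfset G).
Proof. by move=> h; apply/fsetP => e; rewrite mem_glue in_nfset h. Qed.

Lemma mem_shift t d c (e : edge) :
  (shift c e \in nedges t (d + c)) = (e \in nedges t d).
Proof.
rewrite nedges_shift mem_map // => -[x y] [x' y'] [h1 h2].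
congr pair; lia.
Qed.

Lemma nsize_gt0 t : t <> Pt -> 0 < nsize t.
Proof. by case: t. Qed.

Lemma nedges_out t d (e : edge) : ~ (d <= e.1 < e.2 /\ e.2 <= d + nsize t) ->
  (e \in nedges t d) = false.
Proof. by move=> h; apply/negP => /nedges_bound. Qed.

(** The following five glueings build every tree with at least two edges from
    the tree with one edge and the three trees in the triangle.  In this one,
    [glue_prec] and [glue_sum] the glueing diagonal remains exactly when it is
    an edge of the inner tree; it is always removed in [glue_both] and always
    kept in [glue_over]. *)
Lemma glue_succ A : A <> Pt ->
  nfset (Arch A Pt Pt) = nc_glue (nfset (Arch Edge1 Pt Pt)) 1 (nsize A) (nfset A).
Proof.
move/nsize_gt0 => hA; apply: nfset_glue => e.
rewrite /= cats0 /egraft /vgraft /= !inE !add0n addn1 add1n.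
case: (eqVneq e (0, nsize A)) => [->|h] /=; last by rewrite orbT andbT.
by case: eqP => [[]|_] /=; rewrite ?orbF //; lia.
Qed.

Lemma base_shift t :
  ((0, nsize t) \in nedges t 0) = ((1, (nsize t).+1) \in nedges t 1).
Proof. by rewrite -(mem_shift t 0 1) /shift /= !addn1. Qed.

Lemma glue_prec B : B <> Pt ->
  nfset (Arch Pt B Pt) = nc_glue (nfset (Arch Pt Edge1 Pt)) 2 (nsize B) (nfset B).
Proof.
move/nsize_gt0 => hB; apply: nfset_glue => e.
rewrite base_shift /= cats0 /egraft /vgraft /= !inE !add0n.
case: (eqVneq e (1, (nsize B).+1)) => [->|h] /=; last by rewrite orbT andbT.
by rewrite orbF.
Qed.

Lemma glue_sum R : R <> Pt ->
  nfset (Arch Pt Pt R) = nc_glue (nfset (Arch Pt Pt Edge1)) 2 (nsize R) (nfset R).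
Proof.
move/nsize_gt0 => hR; apply: nfset_glue => e.
rewrite base_shift /= /egraft /vgraft /= !inE !add0n.
case: (eqVneq e (1, (nsize R).+1)) => [->|h] /=; last by rewrite orbT andbT.
by rewrite orbF.
Qed.

Lemma glue_both A B : A <> Pt -> B <> Pt ->
  nfset (Arch A B Pt) =
  nc_glue (nfset (Arch Pt B Pt)) 1 (nsize (Arch A Pt Pt)) (nfset (Arch A Pt Pt)).
Proof.
move=> /nsize_gt0 hA /nsize_gt0 hB; apply: nfset_glue => e.
have -> : nsize (Arch A Pt Pt) = (nsize A).+1 by rewrite /= !addn0.
have -> : nedges (Arch Pt B Pt) 0 = (0, (nsize B).+1) :: nedges B 1.
  by rewrite /= cats0.
have -> : nedges (Arch A Pt Pt) 1.-1 = (0, (nsize A).+1) :: nedges A 0.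
  by rewrite /= cats0 addn1.
have -> : nedges (Arch A B Pt) 0 =
    (0, nsize A + (nsize B).+1) :: nedges A 0 ++ nedges B (nsize A).+1.
  by rewrite /= cats0.
rewrite map_cons nedges_graft // /egraft /vgraft /= !inE !mem_cat.
rewrite (nedges_out (e := (0, 1))) /=; last by case.
have -> : ((0, 1) == (0, (nsize B).+1)) = false by apply/eqP => -[]; lia.
have -> : nsize A + (nsize B).+1 = nsize B + (nsize A).+1 by lia.
rewrite add0n add1n !inE orbF /=.
have [->|h] /= := eqVneq e (0, (nsize A).+1).
  rewrite !nedges_out /= ?orbF ?andbF; try lia.
  by apply/eqP => -[]; lia.
by rewrite andbT; congr orb; rewrite orbC.
Qed.

Lemma glue_over A B R : R <> Pt ->
  nfset (Arch A B R) =
  nc_glue (nfset (Arch Pt Pt R)) 1 (nsize (Arch A B Pt)) (nfset (Arch A B Pt)).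
Proof.
move=> /nsize_gt0 hR; apply: nfset_glue => e.
have -> : nsize (Arch A B Pt) = (nsize A + nsize B).+1 by rewrite /= addn0.
have -> : nedges (Arch Pt Pt R) 0 = (0, 1) :: nedges R 1 by [].
rewrite map_cons nedges_graft // /egraft /vgraft /= !inE !mem_cat.
rewrite cats0 !add0n add1n -!addnS eqxx /= andbT inE mem_cat.
by case: (e == _); case: (e \in nedges A 0); case: (e \in nedges B _);
  case: (e \in nedges R _).
Qed.

Lemma ntrees_node A B :
  ntrees (Arch A B Pt) = [seq BNode l r | l <- ntrees A, r <- ntrees B].
Proof.
rewrite /=; elim: [seq _ | _ <- _, _ <- _] => //= u s IH.
by rewrite tprodu0 /= IH.
Qed.

Lemma ntrees_arch A B R : ntrees (Arch A B R) =
  flatten [seq tprod u v | u <- ntrees (Arch A B Pt), v <- ntrees R].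
Proof. by rewrite ntrees_node. Qed.

(** * The image of a noncrossing tree *)

Section Theta.
Variables (K : comNzRingType) (Theta : forall n : nat, nctree n -> {malg K[dterm]}).
Hypothesis hTheta : is_Theta Theta.
Local Open Scope ring_scope.
Notation M := {malg K[dterm]}.
Notation d := dend_of_tree.

(** The size is a variable, constrained by an equation, so that it can be put in
    the form required by [theta_comp]. *)
Definition represents T (f : M) := forall n (X : nctree n),
  n = nsize T -> edges X = nfset T -> dend_eq n (Theta X) f.

Definition ntsum T : M := \sum_(t <- ntrees T) << d t >>.

Lemma ntrees_nonleaf T t : T <> Pt -> t \in ntrees T -> t <> BLeaf.
Proof. by move=> /nsize_gt0 h /ntrees_size e; apply: nonleaf_size; rewrite e. Qed.

Lemma ntsum_arity T : T <> Pt -> of_arity (nsize T) (ntsum T).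
Proof.
move=> hT; apply: of_arity_sum => t ht; apply: of_arityU.
by rewrite arity_dend ?(ntrees_size ht) //; apply: ntrees_nonleaf ht.
Qed.

Lemma represents_glue T F i G f g :
  nfset T = nc_glue (nfset F) i (nsize G) (nfset G) ->
  nsize T = (nsize F + nsize G).-1 ->
  (0 < i <= nsize F)%N -> G <> Pt ->
  (i.-1, i) \in nedges F 0 \/ (0, nsize G)%N \in nedges G 0 ->
  of_arity (nsize F) f -> represents F f -> represents G g ->
  represents T (dcomp f i g).
Proof.
move=> eT sT hi hG hb af hF hg n X hn eX.
move: X eX; rewrite hn sT => X eX.
pose XF := NCTree (nfset_nct F); pose XG := NCTree (nfset_nct G).
have hk := nsize_gt0 hG.
apply: dend_trans (theta_comp hTheta (f := XF) (g := XG) hi hk _ _) _.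
- by rewrite /= !in_nfset.
- by rewrite eX.
apply: dend_comp => //; first exact: theta_arity hTheta _ _ hk.
  exact: hF.
exact: hg.
Qed.

Lemma represents_succ : represents (Arch Edge1 Pt Pt) << DSucc DVar DVar >>.
Proof.
move=> n X hn; move: X; rewrite hn => X eX; apply: (theta_succ hTheta).
by rewrite eX; apply/fsetP => e; rewrite in_nfset !inE.
Qed.

Lemma represents_prec : represents (Arch Pt Edge1 Pt) << DPrec DVar DVar >>.
Proof.
move=> n X hn; move: X; rewrite hn => X eX; apply: (theta_prec hTheta).
by rewrite eX; apply/fsetP => e; rewrite in_nfset !inE.
Qed.

Lemma represents_sum :
  represents (Arch Pt Pt Edge1) (<< DPrec DVar DVar >> + << DSucc DVar DVar >>).
Proof.
move=> n X hn; move: X; rewrite hn => X eX; apply: (theta_sum hTheta).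
by rewrite eX; apply/fsetP => e; rewrite in_nfset !inE.
Qed.

Lemma ntsum_succ A : A <> Pt -> ntsum (Arch A Pt Pt) =
  \sum_(l <- ntrees A) << DSucc (d l) DVar >>.
Proof.
move=> hA; rewrite /ntsum ntrees_node big_allpairs_dep.
apply: eq_big_seq => l /(ntrees_nonleaf hA) hl.
by rewrite big_seq1; case: l hl.
Qed.

Lemma ntsum_prec B : B <> Pt -> ntsum (Arch Pt B Pt) =
  \sum_(r <- ntrees B) << DPrec DVar (d r) >>.
Proof.
move=> hB; rewrite /ntsum ntrees_node big_allpairs_dep big_seq1.
apply: eq_big_seq => r /(ntrees_nonleaf hB) hr.
by rewrite dend_nodeE.
Qed.

Lemma ntsum_arch A B R : ntsum (Arch A B R) =
  \sum_(u <- ntrees (Arch A B Pt)) \sum_(v <- ntrees R)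
    \sum_(t <- tprod u v) << d t >>.
Proof.
rewrite /ntsum (ntrees_arch A B R); move: (ntrees (Arch A B Pt)) => s.
by rewrite big_flatten big_allpairs_dep.
Qed.

(** The arch without R is obtained by glueing the trees for A > x and for x < B
    along a diagonal; then the trees for x * R and for the arch are glued,
    which gives a sum of products of trees. *)
Lemma represents_ntsum T : T <> Pt -> represents T (ntsum T).
Proof.
elim: T => [//|A IA B IB R IR] _.
have rep_succ : A <> Pt -> represents (Arch A Pt Pt) (ntsum (Arch A Pt Pt)).
  move=> hA; have hA' := nsize_gt0 hA.
  have <- : dcomp << DSucc DVar DVar >> 1 (ntsum A) = ntsum (Arch A Pt Pt).
    by rewrite ntsum_succ // dcomp_sumUr.
  apply: (represents_glue (glue_succ hA)) => //=; try lia.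
  - by left; rewrite inE.
  - exact: of_arityU.
  - exact: represents_succ.
  - exact: IA.
have rep_prec : B <> Pt -> represents (Arch Pt B Pt) (ntsum (Arch Pt B Pt)).
  move=> hB; have hB' := nsize_gt0 hB.
  have <- : dcomp << DPrec DVar DVar >> 2 (ntsum B) = ntsum (Arch Pt B Pt).
    by rewrite ntsum_prec // dcomp_sumUr.
  apply: (represents_glue (glue_prec hB)) => //=; try lia.
  - by left; rewrite inE.
  - exact: of_arityU.
  - exact: represents_prec.
  - exact: IB.
have rep_node : represents (Arch A B Pt) (ntsum (Arch A B Pt)).
  have [->|hA] : A = Pt \/ A <> Pt by case: (A); [left|right].
    have [->|hB] : B = Pt \/ B <> Pt by case: (B); [left|right].
      rewrite /ntsum ntrees_node big_seq1 => n X hn; move: X; rewrite hn => X _.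
      exact: theta_unit hTheta _.
    exact: rep_prec.
  have [->|hB] : B = Pt \/ B <> Pt by case: (B); [left|right].
    exact: rep_succ.
  have := represents_glue (glue_both hA hB) _ _ _ _ _ (rep_prec hB) (rep_succ hA).
  have -> : dcomp (ntsum (Arch Pt B Pt)) 1 (ntsum (Arch A Pt Pt)) =
      ntsum (Arch A B Pt).
    rewrite ntsum_prec // ntsum_succ // dcomp_suml.
    rewrite /ntsum ntrees_node big_allpairs_dep.
    rewrite exchange_big; apply: eq_big_seq => r /(ntrees_nonleaf hB) hr.
    rewrite dcomp_sumUr; apply: eq_big_seq => l /(ntrees_nonleaf hA) hl.
    by rewrite dend_nodeE // spineE.
  apply=> //=; try lia.
  - by right; rewrite inE addn1 !addn0 eqxx.
  - exact: ntsum_arity.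
have [->//|hR] : R = Pt \/ R <> Pt by case: (R); [left|right].
have hR' := nsize_gt0 hR.
pose f : M := dcomp (<< DPrec DVar DVar >> + << DSucc DVar DVar >>) 2 (ntsum R).
have aop : of_arity 2 (<< DPrec DVar DVar >> + << DSucc DVar DVar >> : M).
  by apply: of_arityD; exact: of_arityU.
have rep_f : represents (Arch Pt Pt R) f.
  apply: (represents_glue (glue_sum hR)) => //=; try lia.
  - by left; rewrite inE.
  - exact: represents_sum.
  - exact: IR.
have af : of_arity (nsize (Arch Pt Pt R)) f.
  by apply: (of_arity_dcomp (m := 2)) (ntsum_arity hR).
have hN : Arch A B Pt <> Pt by [].
have rep_c : represents (Arch A B R) (dcomp f 1 (ntsum (Arch A B Pt))).
  apply: (represents_glue (glue_over A B hR)) => //.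
  - by rewrite /=; lia.
  - by left; rewrite inE.
move=> n X hn eX; apply: dend_trans (rep_c n X hn eX) _.
have -> : dcomp f 1 (ntsum (Arch A B Pt)) =
   \sum_(v <- ntrees R) \sum_(u <- ntrees (Arch A B Pt))
     (<< DPrec (d u) (d v) >> + << DSucc (d u) (d v) >>).
  rewrite /f dcompDl !dcomp_sumUr /= dcompDl !dcomp_suml -big_split /=.
  by apply: eq_bigr => v _; rewrite !dcomp_sumUr -big_split.
rewrite ntsum_arch exchange_big.
apply: dend_sum => u hu; apply: dend_sum => v hv.
have -> : n = (bsize u + bsize v)%N.
  by rewrite hn (ntrees_size hu) (ntrees_size hv) /=; lia.
by apply: dend_prod; [exact: ntrees_nonleaf hu|exact: ntrees_nonleaf hv].
Qed.

End Theta.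

Lemma interval_poset_ext n P Q : (forall i j, P i j <-> Q i j) ->
  interval_poset n P -> interval_poset n Q.
Proof.
move=> h [p1 p2 p3 p4 p5 p6]; split.
- by move=> i j /h; apply: p1.
- by move=> i /p2 /h.
- by move=> i j /h h1 /h; apply: p3.
- by move=> i j k /h h1 /h h2; apply/h; apply: p4 h1 h2.
- by move=> a b c h1 /h h2; apply/h; apply: p5 h1 h2.
- by move=> a b c h1 /h h2; apply/h; apply: p6 h1 h2.
Qed.

Lemma cover_rel_ext P Q x y : (forall i j, P i j <-> Q i j) ->
  cover_rel P x y -> cover_rel Q x y.
Proof.
by move=> h [h1 h2 h3]; split=> [|//|z /h ? /h]; [apply/h|apply: h3].
Qed.

Theorem theorem3p6 (K : comNzRingType)
    (Theta : forall n : nat, nctree n -> {malg K[dterm]})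
    (hTheta : is_Theta Theta)
    (n : nat) (hn : (1 <= n)%N) (T : nctree n) :
  interval_poset n (nct_lhd T) /\
  exceptional (nct_lhd T) /\
  exists S S' : btree,
    [/\ bsize S = n, bsize S' = n & tam_le S S'] /\
    (forall i j : nat, nct_lhd T i j <-> interval_lhd n S S' i j) /\
    exists I : {fset btree},
      (forall t : btree, t \in I <-> tam_le S t /\ tam_le t S') /\
      (forall J : {fset btree}, is_tree_sum n (Theta n T) J <-> J = I).
Proof.
have [t st eT] := nct_nfset (edgesP T).
have lhdE i j : nlhd t 0 i j <-> nct_lhd T i j by rewrite eT; split=> /nct_lhdP.
split.
  by apply: interval_poset_ext lhdE _; rewrite -st; apply: nlhd_interval_poset.
split.
  case=> x [y [z [h1 h2 h3]]]; apply: (@nlhd_exceptional t); exists x, y, z.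
  by split=> //; [move: h2|move: h3]; apply: cover_rel_ext => i j; split=> /lhdE.
exists (nmin t), (nmax t); split.
  by rewrite bsize_nmin bsize_nmax st; split=> //; apply: nmin_le_nmax.
split.
  move=> i j; have := nlhd_interval t i j; rewrite st => h.
  by split=> [/lhdE/h|/h/lhdE].
pose I := [fset x in ntrees t]%fset.
have memI x : (x \in I) = (x \in ntrees t) by rewrite in_fset.
have sI x : x \in I -> bsize x = n by rewrite memI -st => /ntrees_size.
exists I; split; first by move=> x; rewrite memI; apply: mem_ntrees.
have sumI : dend_eq n (Theta n T) (\sum_(x <- I) << dend_of_tree x >>)%R.
  have -> : (\sum_(x <- I) << dend_of_tree x >>)%R = ntsum K t.
    apply: perm_big; apply: uniq_perm; [exact: fset_uniq|exact: ntrees_uniq|].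
    by move=> x; rewrite memI.
  apply: represents_ntsum => //.
  by move=> e; move: hn; rewrite -st e.
move=> J; split=> [[sJ hJ]|->]; last by split.
by apply: (dend_sum_inj hn sJ sI); apply: dend_trans (dend_sym hJ) sumI.
Qed.
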